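(* Suppose that $k$ is a field of characteristic $0$. Let $\varphi$ be an $\mathcal{L}_k$-sentence of the form $\forall\overline{x}\,\exists!\overline{y}\,(\theta(\overline{x},\overline{y}))$ where $\overline{x},\overline{y}$ are finite tuples of variables and $\theta(\overline{x},\overline{y})$ is a positive Boolean combination of atomic formulas (i.e. built from atomic formulas with $\wedge$ and $\vee$ only). If $\varphi$ holds in all finite dimensional nilpotent mixed structures over $k$, then $\varphi$ holds in all mixed structures over $k$.
   Context: A number $m\in\mathbb{N}$ is identified with $\{0,\dots,m-1\}$. **Summability modules.** For a $k$-module $V$ and a set $I$, $V^{(I)}\subseteq V^I$ is the set of finitely supported maps. A summability structure on $V$ is a class $\Sigma=(\Sigma_I)_{I \text{ a set}}$ of partial maps $\Sigma_I: V^I\to V$, such that each $\operatorname{dom}\Sigma_I$ is a submodule of $V^I$, $\Sigma_I$ is $k$-linear on $\operatorname{dom}\Sigma_I$, and for all sets $I,J$: (SM1) $V^{(I)}\subseteq \operatorname{dom}\Sigma_I$ and $\Sigma_I v=\sum_{v(i)\neq 0}v(i)$ for $v\in V^{(I)}$. (SM2) If $\varphi:I\to J$ is a bijection and $v\in\operatorname{dom}\Sigma_J$, then $v\circ\varphi\in\operatorname{dom}\Sigma_I$ and $\Sigma_I(v\circ\varphi)=\Sigma_J v$. (SM3) If $I=\bigsqcup_{j\in J}I_j$ and $v\in\operatorname{dom}\Sigma_I$, then $v\upharpoonright I_j\in\operatorname{dom}\Sigma_{I_j}$ for each $j$, $(\Sigma_{I_j}(v\upharpoonright I_j))_{j\in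 J}\in\operatorname{dom}\Sigma_J$, and $\Sigma_J(\Sigma_{I_j}(v\upharpoonright I_j))_{j\in J}=\Sigma_I v$. (SM4) If $I\cap J=\varnothing$ and $(v,w)\in\operatorname{dom}\Sigma_I\times\operatorname{dom}\Sigma_J$, then $v\sqcup w\in\operatorname{dom}\Sigma_{I\sqcup J}$. (SM5) If $v\in\operatorname{dom}\Sigma_I$ and $f_i:X_i\to k$ ($i\in I$) are functions with finite domains, then $(f_i(x)v(i))_{i\in I, x\in X_i}\in\operatorname{dom}\Sigma_{\{(i,x): i\in I, x\in X_i\}}$. Elements of $\operatorname{dom}\Sigma_I$ are called summable families. A $k$-linear map $\phi$ is strongly linear if for every summable $v:I\to V$, $\phi\circ v$ is summable and $\Sigma_I(\phi\circ v)=\phi(\Sigma_I v)$. A summability Lie algebra is a Lie algebra $L$ over $k$ with a summability structure such that for all summable $a:I\to L$, $b:J\to L$, the family $([a(i),b(j)])_{(i,j)\in I\times J}$ is summable with sum $[\Sigma_I a,\Sigma_J b]$. A summability subalgebra is a subalgebra containing the sum of each of its families that is summable in the ambient algebra. **Formal series.** For a set $I$, $k\langle\!\langle I\rangle\!\rangle$ is the algebra of formal power series in non-commuting associative variables $X_i$, $i\in I$: all functions from the free monoid $I^\star$ to $k$, with the Cauchy product; a family $(P_j)_j$ is summable iff each word lies in the support of finitely many $P_j$, with pointwise sum. $\mathrm{Lie}\langle\!\langle I\rangle\!\rangle$ is the smallest summability subalgebra of the summability Lie algebra $(k\langle\!\langle I\rangle\!\rangle,[P,Q]=PQ-QP)$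 containing all $X_i$. A summability Lie algebra $L$ has evaluations if for every set $I$ and every summable $a:I\to L$ there is a (necessarily unique) strongly linear Lie algebra morphism $\mathrm{ev}^{\mathrm{Lie}}_a:\mathrm{Lie}\langle\!\langle I\rangle\!\rangle\to L$ with $X_i\mapsto a(i)$. **Mixed structures.** $\mathcal{L}_k$ is the one-sorted first-order language with one $m$-ary function symbol $f$ for each $m\in\mathbb{N}$ and $f\in\mathrm{Lie}\langle\!\langle m\rangle\!\rangle$. A mixed structure (over $k$) is a summability Lie algebra $L$ with evaluations (equivalently, via the formal Lie correspondence, a multipliability exponential group with evaluations), seen as an $\mathcal{L}_k$-structure where $f\in\mathrm{Lie}\langle\!\langle m\rangle\!\rangle$ is interpreted as $L^m\to L$, $\overline b\mapsto\mathrm{ev}^{\mathrm{Lie}}_{\overline b}(f)$ (finite families are always summable). In particular the Lie algebra operations and the group law $a*b=\mathrm{ev}^{\mathrm{Lie}}_{(a,b)}(\log(\exp(X_0)\exp(X_1)))$ are given by symbols of $\mathcal{L}_k$. The dimension of a mixed structure is its dimension as a $k$-vector space; it is nilpotent if its underlying Lie algebra is nilpotent. *)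

(* Defs.v *)
From HB Require Import structures.
From mathcomp Require Import all_boot all_order all_algebra.
From mathcomp Require Import finmap mathcomp_extra boolp classical_sets.
From mathcomp Require Import functions cardinality fsbigop.
From mathcomp Require Import ring.

Set Implicit Arguments.
Unset Strict Implicit.
Unset Printing Implicit Defensive.

Import Order.TTheory GRing.Theory Num.Theory.
Local Open Scope classical_set_scope.
Local Open Scope ring_scope.

(* "Sets" are choiceTypes; since every lmodType is itself a
   choiceType, the carrier of a module may serve as an index set.  Classically
   every type carries a choiceType structure. *)

HB.mixin Record Lmodule_isLieAlgebra (k : fieldType) L of GRing.Lmodule k L := {
  bracket : L -> L -> L;
  bracket_linearl : forall z, linear (bracket^~ z);
  bracket_linearr : forall z, linear (bracket z);
  bracketxx : forall x, bracket x x = 0;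
  jacobi : forall x y z,
    bracket x (bracket y z) + bracket y (bracket z x)
      + bracket z (bracket x y) = 0 }.

#[short(type="lieAlgType")]
HB.structure Definition LieAlgebra (k : fieldType) :=
  { L of Lmodule_isLieAlgebra k L & GRing.Lmodule k L }.

(* The partial map Sigma_I is encoded by its domain [summable I] and a total
   function [ssum I], whose values outside of the domain are irrelevant.
   In SM3 a partition of I into pieces indexed by J (empty pieces being
   allowed) is given as the family of fibers of a map p : I -> J. *)
HB.mixin Record Lmodule_isSummability (k : fieldType) V
    of GRing.Lmodule k V := {
  summable : forall I : choiceType, set (I -> V);
  ssum : forall I : choiceType, (I -> V) -> V;
  summable_linear : forall (I : choiceType) (c : k) (v w : I -> V),
    summable I v -> summable I w -> summable I (fun i => c *: v i + w i);
  ssum_linear : forall (I : choiceType) (c : k) (v w : I -> V),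
    summable I v -> summable I w ->
    ssum I (fun i => c *: v i + w i) = c *: ssum I v + ssum I w;
  SM1 : forall (I : choiceType) (v : I -> V),
    finite_set [set i | v i != 0] ->
    summable I v /\ ssum I v = \sum_(i \in [set: I]) v i;
  SM2 : forall (I J : choiceType) (phi : I -> J) (v : J -> V),
    bijective phi -> summable J v ->
    summable I (v \o phi) /\ ssum I (v \o phi) = ssum J v;
  SM3 : forall (I J : choiceType) (p : I -> J) (v : I -> V),
    summable I v ->
    [/\ forall j, summable {i | p i == j} (fun i => v (val i)),
        summable J (fun j => ssum {i | p i == j} (fun i => v (val i)))
      & ssum J (fun j => ssum {i | p i == j} (fun i => v (val i)))
        = ssum I v];
  SM4 : forall (I J : choiceType) (v : I -> V) (w : J -> V),
    summable I v -> summable J w ->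
    summable (I + J)%type
      (fun u => match u with inl i => v i | inr j => w j end);
  SM5 : forall (I : choiceType) (v : I -> V) (X : I -> finType)
      (f : forall i, X i -> k),
    summable I v ->
    summable {i : I & X i} (fun u => f (tag u) (tagged u) *: v (tag u)) }.

#[short(type="summModType")]
HB.structure Definition SummabilityModule (k : fieldType) :=
  { V of Lmodule_isSummability k V & GRing.Lmodule k V }.

Arguments summable {k V I} _ : rename.
Arguments ssum {k V I} _ : rename.

HB.mixin Record LieSummability_isSummabilityLie (k : fieldType) L
    of LieAlgebra k L & SummabilityModule k L := {
  bracket_ssum : forall (I J : choiceType) (a : I -> L) (b : J -> L),
    summable a -> summable b ->
    summable (fun ij : I * J => bracket (a ij.1) (b ij.2)) /\
    ssum (fun ij : I * J => bracket (a ij.1) (b ij.2))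
      = bracket (ssum a) (ssum b) }.

#[short(type="summLieType")]
HB.structure Definition SummabilityLie (k : fieldType) :=
  { L of LieSummability_isSummabilityLie k L
       & LieAlgebra k L & SummabilityModule k L }.

Definition strongly_linear (k : fieldType) (V W : summModType k)
    (phi : {linear V -> W}) : Prop :=
  forall (I : choiceType) (v : I -> V), summable v ->
    summable (phi \o v) /\ ssum (phi \o v) = phi (ssum v).

Definition lie_morphism (k : fieldType) (L M : lieAlgType k)
    (phi : {linear L -> M}) : Prop :=
  forall x y, phi (bracket x y) = bracket (phi x) (phi y).

Definition summability_subalgebra (k : fieldType) (L : summLieType k)
    (A : set L) : Prop :=
  [/\ GRing.submod_closed (mem A),
      {in A &, forall x y, bracket x y \in A}
    & forall (I : choiceType) (v : I -> L), summable v ->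
        (forall i, v i \in A) -> ssum v \in A].

Lemma smallest_summability_subalgebra (k : fieldType) (L : summLieType k)
    (G : set L) :
  summability_subalgebra (smallest (@summability_subalgebra k L) G).
Proof.
split.
- split=> [|c x y /set_mem xS /set_mem yS]; apply/mem_set => A [AL GA].
    by have [[/set_mem A0 _] _ _] := AL.
  have [[_ AD] _ _] := AL; apply/set_mem/AD; apply/mem_set; [exact: xS|].
  exact: yS.
- move=> x y /set_mem xS /set_mem yS; apply/mem_set => A [AL GA].
  by have [_ AB _] := AL; apply/set_mem/AB; apply/mem_set; [exact: xS|exact: yS].
- move=> I v sv vS; apply/mem_set => A [AL GA].
  have [_ _ AS] := AL; apply/set_mem/AS => // i; apply/mem_set.
  by have /set_mem := vS i; apply.
Qed.

Section FiniteSupportSums.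
Variable k : fieldType.

Lemma fsum_seq (V : nmodType) (J : choiceType) (r : seq J) (F : J -> V) :
  uniq r -> (forall j, j \notin r -> F j = 0) ->
  \sum_(j \in [set: J]) F j = \sum_(j <- r) F j.
Proof.
move=> r_uniq F0; rewrite (@fsbigTE _ _ _ _ [fset x in r]%fset); last first.
  by move=> j; rewrite in_fset => /F0.
by apply: perm_big; apply: uniq_perm => // j; rewrite in_fset.
Qed.

Lemma finite_suppP (V : nmodType) (J : choiceType) (F : J -> V) :
  finite_set [set j | F j != 0] ->
  exists2 r : seq J, uniq r & forall j, j \notin r -> F j = 0.
Proof.
move=> /finite_fsetP[X XE]; exists X => // j jX.
apply: contraNeq jX => Fj; have : [set j | F j != 0] j by [].
by rewrite XE.
Qed.

Lemma fsum_linear (J : choiceType) (c : k) (F G : J -> k) :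
  finite_set [set j | F j != 0] -> finite_set [set j | G j != 0] ->
  \sum_(j \in [set: J]) (c * F j + G j)
  = c * (\sum_(j \in [set: J]) F j) + \sum_(j \in [set: J]) G j.
Proof.
move=> /finite_suppP[r _ rF] /finite_suppP[s _ sG].
pose t := undup (r ++ s).
have tF j : j \notin t -> F j = 0.
  by rewrite mem_undup mem_cat => /norP[/rF].
have tG j : j \notin t -> G j = 0.
  by rewrite mem_undup mem_cat => /norP[_ /sG].
rewrite !(fsum_seq (undup_uniq (r ++ s))) -/t//; last first.
  by move=> j jt; rewrite tF// tG// mulr0 addr0.
by rewrite big_split/= mulr_sumr.
Qed.

Lemma fsum_fiber (I J : choiceType) (p : I -> J) (F : I -> k) :
  finite_set [set i | F i != 0] ->
  [/\ forall j, finite_set [set i : {i | p i == j} | F (val i) != 0],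
      finite_set [set j |
        \sum_(i \in [set: {i | p i == j}]) F (val i) != 0]
    & \sum_(j \in [set: J]) \sum_(i \in [set: {i | p i == j}]) F (val i)
      = \sum_(i \in [set: I]) F i].
Proof.
move=> fin; split.
- move=> j; apply: (@finite_preimage _ _ [set i | F i != 0]) fin.
  by move=> x y _ _; exact: val_inj.
- apply: sub_finite_set (finite_image p fin) => j /= /eqP Fj.
  apply: contrapT => Nj; apply: Fj; apply: fsbig1 => -[i /= /eqP pij] _.
  by apply/eqP; apply: contrapT => /negP Fi; apply: Nj; exists i.
have [r r_uniq rF] := finite_suppP fin.
have inner j : \sum_(i \in [set: {i | p i == j}]) F (val i)
    = \sum_(i <- r | p i == j) F i.
  rewrite -(reindex_fsbig (fun i : {i | p i == j} => val i)
    [set: {i | p i == j}] [set i | p i = j] F); last first.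
    split=> [[i /= /eqP//]|x y _ _|i /= /eqP pij]; first exact: val_inj.
    by exists (exist _ i pij).
  rewrite fsbig_mkcond (fsum_seq r_uniq) => [|i ir]; last first.
    by rewrite /patch rF ?if_same.
  rewrite [RHS]big_mkcond/=; apply: eq_bigr => i _; rewrite /patch.
  by have [/set_mem /= -> | /negP] := boolP (i \in [set i | p i = j]);
    rewrite ?eqxx// inE; case: eqP.
under eq_fsbigr do rewrite inner.
rewrite (@fsum_seq _ _ (undup (map p r))) ?undup_uniq//; last first.
  move=> j; rewrite mem_undup => jr; rewrite big_seq_cond big1// => i.
  by case/andP => ir /eqP pij; rewrite -pij map_f in jr.
rewrite (fsum_seq r_uniq rF) (exchange_big_dep predT)//=.
apply: eq_big_seq => i ir; rewrite -big_filter.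
have -> : [seq j <- undup (map p r) | p i == j] = [:: p i].
  apply: perm_small_eq => //; apply: uniq_perm.
  - exact/filter_uniq/undup_uniq.
  - by [].
  - move=> j; rewrite mem_filter mem_undup inE eq_sym.
    by case: eqP => // ->; rewrite map_f.
by rewrite big_seq1.
Qed.

End FiniteSupportSums.

Section NCSeries.
Variables (k : fieldType) (I : choiceType).

Definition ncseries : Type := seq I -> k^o.

HB.instance Definition _ := GRing.Lmodule.on ncseries.

Definition ncseries_one : ncseries := fun w => (w == [::])%:R.

Definition ncseries_mul (P Q : ncseries) : ncseries :=
  fun w => \sum_(i < (size w).+1) P (take i w) * Q (drop i w).

Definition ncvar (i : I) : ncseries := fun w => (w == [:: i])%:R.


Implicit Types P Q R : ncseries.

Definition ncseries_lderiv (a : I) P : ncseries := fun w => P (a :: w).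

Lemma ncseriesDE P Q w : (P + Q) w = P w + Q w. Proof. by []. Qed.
Lemma ncseriesZE (c : k) P w : (c *: P) w = c * P w. Proof. by []. Qed.

Lemma ncseries_mul_nil P Q : ncseries_mul P Q [::] = P [::] * Q [::].
Proof. by rewrite /ncseries_mul big_ord_recl big_ord0 addr0. Qed.

Lemma ncseries_mul_cons P Q a w :
  ncseries_mul P Q (a :: w)
  = P [::] * Q (a :: w) + ncseries_mul (ncseries_lderiv a P) Q w.
Proof. by rewrite /ncseries_mul big_ord_recl. Qed.

Lemma ncseries_mulDl : left_distributive ncseries_mul +%R.
Proof.
move=> P Q R; apply/funext => w; rewrite ncseriesDE /ncseries_mul -big_split/=.
by apply: eq_bigr => i _; rewrite ncseriesDE mulrDl.
Qed.

Lemma ncseries_mulDr : right_distributive ncseries_mul +%R.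
Proof.
move=> P Q R; apply/funext => w; rewrite ncseriesDE /ncseries_mul -big_split/=.
by apply: eq_bigr => i _; rewrite ncseriesDE mulrDr.
Qed.

Lemma ncseries_mulZl (c : k) P Q :
  c *: ncseries_mul P Q = ncseries_mul (c *: P) Q.
Proof.
apply/funext => w; rewrite ncseriesZE /ncseries_mul mulr_sumr.
by apply: eq_bigr => i _; rewrite ncseriesZE mulrA.
Qed.

Lemma ncseries_mulZr (c : k) P Q :
  c *: ncseries_mul P Q = ncseries_mul P (c *: Q).
Proof.
apply/funext => w; rewrite ncseriesZE /ncseries_mul mulr_sumr.
by apply: eq_bigr => i _; rewrite ncseriesZE mulrCA.
Qed.

Lemma ncseries_mulA : associative ncseries_mul.
Proof.
move=> P Q R; apply/funext => w; elim: w P Q => [|a w IHw] P Q.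
  by rewrite !ncseries_mul_nil mulrA.
rewrite !ncseries_mul_cons ncseries_mul_nil IHw mulrDr mulrA -addrA.
congr (_ + _).
have -> : ncseries_lderiv a (ncseries_mul P Q)
    = P [::] *: ncseries_lderiv a Q + ncseries_mul (ncseries_lderiv a P) Q.
  by apply/funext => v; rewrite /ncseries_lderiv ncseries_mul_cons.
by rewrite ncseries_mulDl -ncseries_mulZl ncseriesDE ncseriesZE.
Qed.

Lemma ncseries_mul1P : left_id ncseries_one ncseries_mul.
Proof.
move=> P; apply/funext => w; rewrite /ncseries_mul big_ord_recl/= drop0.
rewrite take0 mul1r big1 ?addr0// => i _; case: w i => [[]//|a w] i.
by rewrite /ncseries_one/= mul0r.
Qed.

Lemma ncseries_mulP1 : right_id ncseries_one ncseries_mul.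
Proof.
move=> P; apply/funext => w; elim: w P => [|a w IHw] P.
  by rewrite ncseries_mul_nil mulr1.
by rewrite ncseries_mul_cons IHw mulr0 add0r.
Qed.

Lemma ncseries_oner_neq0 : ncseries_one != 0.
Proof. by apply/eqP => /(congr1 (@^~ [::])) /eqP; rewrite (oner_eq0 k). Qed.

HB.instance Definition _ := GRing.Zmodule_isNzRing.Build ncseries
  ncseries_mulA ncseries_mul1P ncseries_mulP1 ncseries_mulDl ncseries_mulDr
  ncseries_oner_neq0.

HB.instance Definition _ :=
  GRing.Lmodule_isLalgebra.Build k ncseries ncseries_mulZl.
HB.instance Definition _ :=
  GRing.Lalgebra_isAlgebra.Build k ncseries ncseries_mulZr.


Definition ncseries_bracket P Q : ncseries := P * Q - Q * P.

Lemma ncseries_bracket_linearl Q : linear (ncseries_bracket^~ Q).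
Proof.
move=> c P P'; rewrite /ncseries_bracket mulrDl mulrDr -scalerAl -scalerAr.
by rewrite scalerBr opprD addrACA.
Qed.

Lemma ncseries_bracket_linearr P : linear (ncseries_bracket P).
Proof.
move=> c Q Q'; rewrite /ncseries_bracket mulrDl mulrDr -scalerAl -scalerAr.
by rewrite scalerBr opprD addrACA.
Qed.

Lemma ncseries_bracketxx P : ncseries_bracket P P = 0.
Proof. exact: subrr. Qed.

Lemma ncseries_jacobi P Q R :
  ncseries_bracket P (ncseries_bracket Q R)
  + ncseries_bracket Q (ncseries_bracket R P)
  + ncseries_bracket R (ncseries_bracket P Q) = 0.
Proof.
rewrite /ncseries_bracket !mulrBl !mulrBr !mulrA.
have E (a b c d e f : k) : a - b - (c - d) + (c - e - (f - b))
    + (f - d - (a - e)) = 0 by ring.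
apply/funext => w; exact: E.
Qed.

HB.instance Definition _ := Lmodule_isLieAlgebra.Build k ncseries
  ncseries_bracket_linearl ncseries_bracket_linearr ncseries_bracketxx
  ncseries_jacobi.

Lemma ncseriesME P Q w :
  (P * Q) w = \sum_(n < (size w).+1) P (take n w) * Q (drop n w).
Proof. by []. Qed.

(* Each word lies in the support of finitely many members of the family. *)
Definition ncseries_summable (J : choiceType) : set (J -> ncseries) :=
  [set P | forall w, finite_set [set j | P j w != 0]].

Definition ncseries_sum (J : choiceType) (P : J -> ncseries) : ncseries :=
  fun w => \sum_(j \in [set: J]) P j w.

Lemma ncseries_summable_linear (J : choiceType) (c : k) (P Q : J -> ncseries) :
  ncseries_summable P -> ncseries_summable Q ->
  ncseries_summable (fun j => c *: P j + Q j).
Proof.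
move=> sP sQ w.
apply: (@sub_finite_set _ _ ([set j | P j w != 0] `|` [set j | Q j w != 0])).
  move=> j /=; rewrite ncseriesDE ncseriesZE.
  have [->|] := eqVneq (P j w) 0; last by left.
  by rewrite mulr0 add0r; right.
by rewrite finite_setU; split; [exact: sP|exact: sQ].
Qed.

Lemma ncseries_sum_linear (J : choiceType) (c : k) (P Q : J -> ncseries) :
  ncseries_summable P -> ncseries_summable Q ->
  ncseries_sum (fun j => c *: P j + Q j)
  = c *: ncseries_sum P + ncseries_sum Q.
Proof.
move=> sP sQ; apply/funext => w; rewrite ncseriesDE ncseriesZE.
exact: (fsum_linear c (sP w) (sQ w)).
Qed.

Lemma ncseries_SM1 (J : choiceType) (P : J -> ncseries) :
  finite_set [set j | P j != 0] ->
  ncseries_summable P /\ ncseries_sum P = \sum_(j \in [set: J]) P j.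
Proof.
move=> fin; split=> [w|].
  apply: sub_finite_set fin => j /=; apply: contra_neq => ->.
  by [].
have [r r_uniq rP] := finite_suppP fin.
apply/funext => w; rewrite (fsum_seq r_uniq rP) /ncseries_sum.
rewrite (fsum_seq r_uniq); last by move=> j /rP ->.
by elim: {r_uniq rP} r => [|j r IHr]; rewrite ?big_nil// !big_cons IHr.
Qed.

Lemma ncseries_SM2 (J J' : choiceType) (phi : J -> J') (P : J' -> ncseries) :
  bijective phi -> ncseries_summable P ->
  ncseries_summable (P \o phi) /\ ncseries_sum (P \o phi) = ncseries_sum P.
Proof.
move=> phi_bij sP; split=> [w|].
  apply: (@finite_preimage _ _ [set j | P j w != 0]) (sP w).
  by move=> x y _ _; exact: bij_inj.
apply/funext => w; rewrite /ncseries_sum/=.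
by rewrite (reindex_fsbigT phi (fun j => P j w : k)).
Qed.

Lemma ncseries_SM3 (J J' : choiceType) (p : J -> J') (P : J -> ncseries) :
  ncseries_summable P ->
  [/\ forall j, ncseries_summable (fun i : {i | p i == j} => P (val i)),
      ncseries_summable
        (fun j => ncseries_sum (fun i : {i | p i == j} => P (val i)))
    & ncseries_sum
        (fun j => ncseries_sum (fun i : {i | p i == j} => P (val i)))
      = ncseries_sum P].
Proof.
move=> sP; split=> [j w|w|].
- by have [fin _ _] := fsum_fiber p (sP w); exact: fin.
- by have [_ fin _] := fsum_fiber p (sP w); exact: fin.
- by apply/funext => w; have [_ _ sumE] := fsum_fiber p (sP w); exact: sumE.
Qed.

Lemma ncseries_SM4 (J J' : choiceType) (P : J -> ncseries)
    (Q : J' -> ncseries) :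
  ncseries_summable P -> ncseries_summable Q ->
  @ncseries_summable (J + J')%type
    (fun u => match u with inl i => P i | inr j => Q j end).
Proof.
move=> sP sQ w; apply: (@sub_finite_set _ _
  ((inl @` [set j | P j w != 0]) `|` (inr @` [set j | Q j w != 0]))).
  by move=> [i|j] /= ?; [left; exists i|right; exists j].
by rewrite finite_setU; split; apply: finite_image.
Qed.

Lemma ncseries_SM5 (J : choiceType) (P : J -> ncseries) (X : J -> finType)
    (f : forall j, X j -> k) :
  ncseries_summable P ->
  @ncseries_summable {j : J & X j}
    (fun u => f (tag u) (tagged u) *: P (tag u)).
Proof.
move=> sP w; apply: (@sub_finite_set _ _ (\bigcup_(j in [set j | P j w != 0])
  [set Tagged X x | x in [set: X j]])).
  move=> [j x] /=; rewrite ncseriesZE => fP.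
  exists j; last by exists x.
  by apply: contra_neq fP => /= ->; rewrite mulr0.
apply: bigcup_finite => // j _; apply: finite_image; exact: finite_finset.
Qed.

HB.instance Definition _ := Lmodule_isSummability.Build k ncseries
  ncseries_summable_linear ncseries_sum_linear ncseries_SM1 ncseries_SM2
  ncseries_SM3 ncseries_SM4 ncseries_SM5.

Lemma ncseries_mul_sum (J J' : choiceType) (P : J -> ncseries)
    (Q : J' -> ncseries) :
  ncseries_summable P -> ncseries_summable Q ->
  ncseries_summable (fun ij : J * J' => P ij.1 * Q ij.2) /\
  ncseries_sum (fun ij : J * J' => P ij.1 * Q ij.2)
  = ncseries_sum P * ncseries_sum Q.
Proof.
move=> sP sQ.
have cover w : exists (r : seq J) (s : seq J'), [/\ uniq r, uniq s,
    forall (n : 'I_(size w).+1) i, i \notin r -> P i (take n w) = 0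
  & forall (n : 'I_(size w).+1) j, j \notin s -> Q j (drop n w) = 0].
  have rX n : exists r : seq J, forall i, i \notin r -> P i (take n w) = 0.
    by have [r _ rP] := finite_suppP (sP (take n w)); exists r.
  have sX n : exists s : seq J', forall j, j \notin s -> Q j (drop n w) = 0.
    by have [s _ sQ'] := finite_suppP (sQ (drop n w)); exists s.
  have [r rP] := boolp.choice rX; have [s sQ'] := boolp.choice sX.
  exists (undup (flatten [seq r (val n) | n <- enum 'I_(size w).+1])).
  exists (undup (flatten [seq s (val n) | n <- enum 'I_(size w).+1])).
  split; rewrite ?undup_uniq// => n i; rewrite mem_undup => iN.
    apply: rP; apply: contra iN => iN; apply/flattenP; exists (r n) => //.
    by apply/mapP; exists n; rewrite ?mem_enum.
  apply: sQ'; apply: contra iN => iN; apply/flattenP; exists (s n) => //.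
  by apply/mapP; exists n; rewrite ?mem_enum.
have zero w (r : seq J) (s : seq J') : (forall (n : 'I_(size w).+1) i,
      i \notin r -> P i (take n w) = 0) ->
    (forall (n : 'I_(size w).+1) j, j \notin s -> Q j (drop n w) = 0) ->
    forall ij, ij \notin [seq (i, j) | i <- r, j <- s] ->
    (P ij.1 * Q ij.2) w = 0.
  move=> rP sQ' [i j] ijN; apply: big1 => n _ /=.
  have [ir|/rP->] := boolP (i \in r); last by rewrite mul0r.
  have [js|/sQ'->] := boolP (j \in s); last by rewrite mulr0.
  by rewrite allpairs_f in ijN.
split=> [w|].
  have [r [s [_ _ rP sQ']]] := cover w.
  apply: sub_finite_set (finite_seq [seq (i, j) | i <- r, j <- s]) => ij /=.
  by apply: contraR => /(zero w r s rP sQ') ->.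
apply/funext => w; have [r [s [r_uniq s_uniq rP sQ']]] := cover w.
have rs_uniq : uniq [seq (i, j) | i <- r, j <- s].
  by apply: allpairs_uniq => // -[? ?] [? ?].
rewrite ncseriesME /ncseries_sum (fsum_seq rs_uniq (zero w r s rP sQ')).
rewrite big_allpairs/=.
rewrite [RHS](eq_bigr (fun n : 'I_(size w).+1 =>
  \sum_(i <- r) \sum_(j <- s) P i (take n w) * Q j (drop n w))).
  rewrite [RHS]exchange_big/=; apply: eq_bigr => i _.
  by rewrite [RHS]exchange_big/=; apply: eq_bigr.
move=> n _; rewrite (fsum_seq r_uniq (rP n)) (fsum_seq s_uniq (sQ' n)).
by rewrite mulr_suml; apply: eq_bigr => i _; rewrite mulr_sumr.
Qed.

Lemma ncseries_bracket_ssum (J J' : choiceType) (P : J -> ncseries)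
    (Q : J' -> ncseries) :
  summable P -> summable Q ->
  summable (fun ij : J * J' => bracket (P ij.1) (Q ij.2)) /\
  ssum (fun ij : J * J' => bracket (P ij.1) (Q ij.2))
  = bracket (ssum P) (ssum Q).
Proof.
move=> sP sQ.
have [sPQ PQE] := ncseries_mul_sum sP sQ.
have [sQP QPE] := ncseries_mul_sum sQ sP.
have swap_bij : bijective (fun ij : J * J' => (ij.2, ij.1)).
  by exists (fun ij : J' * J => (ij.2, ij.1)) => -[].
have [sQP' QPE'] := SM2 _ _ _ _ swap_bij sQP.
have bE : (fun ij : J * J' => bracket (P ij.1) (Q ij.2))
    = (fun ij => (-1) *: (Q ij.2 * P ij.1) + P ij.1 * Q ij.2).
  by apply/funext => ij; rewrite scaleN1r addrC.
rewrite bE; split; first exact: (summable_linear _ _ _ _ sQP' sPQ).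
have /= -> := ssum_linear _ (-1) _ _ sQP' sPQ.
have /= -> := QPE'.
by rewrite scaleN1r addrC; congr (_ - _).
Qed.

HB.instance Definition _ :=
  LieSummability_isSummabilityLie.Build k ncseries ncseries_bracket_ssum.

End NCSeries.

Section LieSeries.
Variables (k : fieldType) (I : choiceType).
Local Notation ncs := (ncseries k I).

Definition lie_set : set ncs :=
  smallest (@summability_subalgebra k ncs) (range (@ncvar k I)).

Definition lie_pred : {pred ncs} := mem lie_set.

Lemma lie_set_subalgebra : summability_subalgebra lie_set.
Proof. exact: smallest_summability_subalgebra. Qed.

Lemma lie_pred_submod_closed : GRing.subsemimod_closed lie_pred.
Proof.
by apply: GRing.submod_closed_semi; have [] := lie_set_subalgebra.
Qed.

HB.instance Definition _ :=
  GRing.isSubmodClosed.Build k ncs lie_pred lie_pred_submod_closed.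

Record lieseries := LieSeries {
  lieseries_val : ncs;
  lieseriesP : lieseries_val \in lie_pred }.

HB.instance Definition _ := [isSub for lieseries_val].
HB.instance Definition _ := [Choice of lieseries by <:].
HB.instance Definition _ := [SubChoice_isSubLmodule of lieseries by <:].

Lemma lie_bracketP (P Q : lieseries) : bracket (lieseries_val P) (lieseries_val Q) \in lie_pred.
Proof.
have [_ closedB _] := lie_set_subalgebra.
by apply: closedB; exact: lieseriesP.
Qed.

Definition lie_bracket (P Q : lieseries) : lieseries :=
  LieSeries (lie_bracketP P Q).

Lemma lie_bracket_linearl Q : linear (lie_bracket^~ Q).
Proof. by move=> c P P'; apply: val_inj; exact: bracket_linearl. Qed.

Lemma lie_bracket_linearr P : linear (lie_bracket P).
Proof. by move=> c Q Q'; apply: val_inj; exact: bracket_linearr. Qed.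

Lemma lie_bracketxx P : lie_bracket P P = 0.
Proof. by apply: val_inj; exact: bracketxx. Qed.

Lemma lie_jacobi P Q R :
  lie_bracket P (lie_bracket Q R) + lie_bracket Q (lie_bracket R P)
    + lie_bracket R (lie_bracket P Q) = 0.
Proof. by apply: val_inj; exact: jacobi. Qed.

HB.instance Definition _ := Lmodule_isLieAlgebra.Build k lieseries
  lie_bracket_linearl lie_bracket_linearr lie_bracketxx lie_jacobi.

(* The default value 0 is never used on summable families, see lie_sumE. *)
Definition lie_summable (J : choiceType) : set (J -> lieseries) :=
  [set P : J -> lieseries | summable (fun j => lieseries_val (P j))].

Definition lie_sum (J : choiceType) (P : J -> lieseries) : lieseries :=
  insubd 0 (ssum (fun j => lieseries_val (P j))).

Lemma lie_sumE (J : choiceType) (P : J -> lieseries) :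
  lie_summable P -> val (lie_sum P) = ssum (val \o P).
Proof.
move=> sP; rewrite val_insubd.
have [_ _ closedS] := lie_set_subalgebra.
by rewrite [_ \in _](closedS _ _ sP) // => j; exact: lieseriesP.
Qed.

Lemma lie_summable_linear (J : choiceType) (c : k) (P Q : J -> lieseries) :
  lie_summable P -> lie_summable Q ->
  lie_summable (fun j => c *: P j + Q j).
Proof. by move=> sP sQ; exact: (summable_linear _ c _ _ sP sQ). Qed.

Lemma lie_sum_linear (J : choiceType) (c : k) (P Q : J -> lieseries) :
  lie_summable P -> lie_summable Q ->
  lie_sum (fun j => c *: P j + Q j) = c *: lie_sum P + lie_sum Q.
Proof.
move=> sP sQ; apply: val_inj.
rewrite lie_sumE; last exact: lie_summable_linear.
rewrite [RHS](_ : _ = c *: val (lie_sum P) + val (lie_sum Q))// !lie_sumE//.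
exact: (ssum_linear _ c _ _ sP sQ).
Qed.

Lemma lie_SM1 (J : choiceType) (P : J -> lieseries) :
  finite_set [set j | P j != 0] ->
  lie_summable P /\ lie_sum P = \sum_(j \in [set: J]) P j.
Proof.
move=> fin.
have fin' : finite_set [set j | (val \o P) j != 0].
  by apply: sub_finite_set fin => j /=; apply: contra_neq => ->.
have [sP PE] := SM1 _ _ fin'; split=> //.
apply: val_inj; rewrite lie_sumE// PE.
have [r r_uniq rP] := finite_suppP fin.
rewrite !(fsum_seq r_uniq)//; last by move=> j /rP /= ->.
by rewrite (big_morph val (id1 := 0) (op1 := +%R)).
Qed.

Lemma lie_SM2 (J J' : choiceType) (phi : J -> J') (P : J' -> lieseries) :
  bijective phi -> lie_summable P ->
  lie_summable (P \o phi) /\ lie_sum (P \o phi) = lie_sum P.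
Proof.
move=> phi_bij sP; have [sPphi E] := SM2 _ _ _ _ phi_bij sP; split=> //.
by apply: val_inj; rewrite !lie_sumE.
Qed.

Lemma lie_SM3 (J J' : choiceType) (p : J -> J') (P : J -> lieseries) :
  lie_summable P ->
  [/\ forall j, lie_summable (fun i : {i | p i == j} => P (val i)),
      lie_summable (fun j => lie_sum (fun i : {i | p i == j} => P (val i)))
    & lie_sum (fun j => lie_sum (fun i : {i | p i == j} => P (val i)))
      = lie_sum P].
Proof.
move=> sP; have [sfib ssfib E] := SM3 _ _ p _ sP.
have fibE : (fun j => lieseries_val
      (lie_sum (fun i : {i | p i == j} => P (val i))))
    = (fun j => ssum (fun i : {i | p i == j} => lieseries_val (P (val i)))).
  by apply/funext => j /=; exact: (lie_sumE (sfib j)).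
have ssfib' :
    lie_summable (fun j => lie_sum (fun i : {i | p i == j} => P (val i))).
  by rewrite /lie_summable/= fibE.
split=> //; apply: val_inj; rewrite (lie_sumE ssfib') (lie_sumE sP) -E.
by congr ssum.
Qed.

Lemma lie_SM4 (J J' : choiceType) (P : J -> lieseries) (Q : J' -> lieseries) :
  lie_summable P -> lie_summable Q ->
  @lie_summable (J + J')%type
    (fun u => match u with inl i => P i | inr j => Q j end).
Proof.
move=> sP sQ; rewrite /lie_summable/=.
rewrite (_ : (fun u => _) = (fun u : J + J' => match u with
  inl i => lieseries_val (P i) | inr j => lieseries_val (Q j) end)).
  exact: SM4.
by apply/funext => -[].
Qed.

Lemma lie_SM5 (J : choiceType) (P : J -> lieseries) (X : J -> finType)
    (f : forall j, X j -> k) :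
  lie_summable P ->
  @lie_summable {j : J & X j}
    (fun u => f (tag u) (tagged u) *: P (tag u)).
Proof. by move=> sP; exact: (SM5 _ _ X f sP). Qed.

HB.instance Definition _ := Lmodule_isSummability.Build k lieseries
  lie_summable_linear lie_sum_linear lie_SM1 lie_SM2 lie_SM3 lie_SM4 lie_SM5.

Lemma lie_bracket_ssum (J J' : choiceType) (P : J -> lieseries)
    (Q : J' -> lieseries) :
  summable P -> summable Q ->
  summable (fun ij : J * J' => bracket (P ij.1) (Q ij.2)) /\
  ssum (fun ij : J * J' => bracket (P ij.1) (Q ij.2))
  = bracket (ssum P) (ssum Q).
Proof.
move=> sP sQ; have [sPQ E] := bracket_ssum _ _ _ _ sP sQ.
split=> //; apply: val_inj.
have -> := @lie_sumE _ (fun ij : J * J' => bracket (P ij.1) (Q ij.2)) sPQ.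
have -> : val (bracket (ssum P) (ssum Q))
    = bracket (val (lie_sum P)) (val (lie_sum Q)) by [].
by rewrite (lie_sumE sP) (lie_sumE sQ).
Qed.

HB.instance Definition _ :=
  LieSummability_isSummabilityLie.Build k lieseries lie_bracket_ssum.

Lemma lievarP (i : I) : ncvar k i \in lie_pred.
Proof. by apply/mem_set; apply: sub_gen_smallest; exists i. Qed.

Definition lievar (i : I) : lieseries := LieSeries (lievarP i).

End LieSeries.

Arguments lievar {k I} i.

Definition is_evaluation (k : fieldType) (L : summLieType k) (I : choiceType)
    (a : I -> L) (ev : {linear lieseries k I -> L}) : Prop :=
  [/\ lie_morphism ev, strongly_linear ev & forall i, ev (lievar i) = a i].

Definition has_evaluations (k : fieldType) (L : summLieType k) : Prop :=
  forall (I : choiceType) (a : I -> L), summable a ->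
    exists ev : {linear lieseries k I -> L}, is_evaluation a ev.

Lemma evaluation_unique (k : fieldType) (L : summLieType k) (I : choiceType)
    (a : I -> L) (ev ev' : {linear lieseries k I -> L}) :
  is_evaluation a ev -> is_evaluation a ev' -> ev =1 ev'.
Proof.
move=> [evB evS evX] [evB' evS' evX'].
pose E : set (ncseries k I) :=
  [set P | exists Q : lieseries k I, val Q = P /\ ev Q = ev' Q].
have Esub : summability_subalgebra E.
  split.
  - split=> [|c x y /set_mem[P [<- PE]] /set_mem[Q [<- QE]]]; apply/mem_set.
      by exists 0; rewrite !linear0.
    by exists (c *: P + Q); rewrite !linearP PE QE.
  - move=> x y /set_mem[P [<- PE]] /set_mem[Q [<- QE]]; apply/mem_set.
    by exists (bracket P Q); rewrite evB evB' PE QE.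
  - move=> J v sv vE; apply/mem_set.
    have {vE} /boolp.choice[Q QE] : forall j, exists Q : lieseries k I,
        val Q = v j /\ ev Q = ev' Q by move=> j; exact: set_mem (vE j).
    have QvE : (fun j => lieseries_val (Q j)) = v.
      by apply/funext => j; have [] := QE j.
    have sQ : summable Q.
      by change (summable (fun j => lieseries_val (Q j))); rewrite QvE.
    exists (ssum Q); split; first by rewrite -QvE; exact: lie_sumE.
    have [_ <-] := evS _ _ sQ; have [_ <-] := evS' _ _ sQ.
    by congr ssum; apply/funext => j; have [] := QE j.
have XE : range (@ncvar k I) `<=` E.
  by move=> _ [i _ <-]; exists (lievar i); rewrite evX evX'.
move=> P; have /set_mem /(smallest_sub Esub XE) [Q [/val_inj <- //]] := lieseriesP P.
Qed.

HB.mixin Record SummabilityLie_isMixed (k : fieldType) L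
    of SummabilityLie k L := {
  mixed_evaluations : has_evaluations L }.

#[short(type="mixedType")]
HB.structure Definition Mixed (k : fieldType) :=
  { L of SummabilityLie_isMixed k L & SummabilityLie k L }.

Lemma finite_summable (k : fieldType) (V : summModType k) (I : finType)
    (v : I -> V) : summable v.
Proof. by have [] := SM1 I v finite_finset. Qed.

Definition ev_lie (k : fieldType) (L : mixedType k) (m : nat)
    (b : 'I_m -> L) : {linear lieseries k 'I_m -> L} :=
  projT1 (cid (mixed_evaluations 'I_m b (finite_summable b))).

Lemma ev_lieP (k : fieldType) (L : mixedType k) (m : nat) (b : 'I_m -> L) :
  is_evaluation b (ev_lie b).
Proof. by rewrite /ev_lie; case: cid. Qed.

(* [term k W]: terms of the language L_k with variables in W; there is one
   m-ary function symbol for each f in Lie<<m>>, the number m being identified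
   with 'I_m. *)
Inductive term (k : fieldType) (W : Type) : Type :=
| Var of W
| App (m : nat) of lieseries k 'I_m & ('I_m -> term k W).

Fixpoint eval (k : fieldType) (W : Type) (L : mixedType k) (e : W -> L)
    (t : term k W) : L :=
  match t with
  | Var x => e x
  | App _ f ts => ev_lie (fun i => eval e (ts i)) f
  end.

(* L_k has no relation symbols, so its atomic formulas are equations. *)
Inductive pos_formula (k : fieldType) (W : Type) : Type :=
| FEq of term k W & term k W
| FAnd of pos_formula k W & pos_formula k W
| FOr of pos_formula k W & pos_formula k W.

Fixpoint satisfies (k : fieldType) (W : Type) (L : mixedType k) (e : W -> L)
    (theta : pos_formula k W) : Prop :=
  match theta with
  | FEq s t => eval e s = eval e t
  | FAnd theta1 theta2 => satisfies e theta1 /\ satisfies e theta2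
  | FOr theta1 theta2 => satisfies e theta1 \/ satisfies e theta2
  end.

(* L satisfies the sentence: for all x, there is a unique y with
   theta(x, y), where x and y are tuples of n and p variables. *)
Definition holds_forall_exists_unique (k : fieldType) (n p : nat)
    (theta : pos_formula k ('I_n + 'I_p)) (L : mixedType k) : Prop :=
  forall x : 'I_n -> L, exists! y : 'I_p -> L,
    satisfies (fun v => match v with inl i => x i | inr j => y j end) theta.

Definition finite_dimensional (k : fieldType) (V : lmodType k) : Prop :=
  exists d : nat, inhabited (Vector.axiom d V).

(* The descending central series, [lower_central L 0] being L itself; each
   term is a linear span. *)
Fixpoint lower_central (k : fieldType) (L : lieAlgType k) (c : nat) : set L :=
  if c is c'.+1 then
    smallest (fun A : set L => GRing.submod_closed (mem A))
      [set bracket x y | x in [set: L] & y in @lower_central k L c']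
  else [set: L].

Arguments lower_central {k} L c.

Definition lie_nilpotent (k : fieldType) (L : lieAlgType k) : Prop :=
  exists c, lower_central L c = [set 0].

(* Main.v *)
(* Let Lie<<J>> be the Lie series in finitely many variables and phi a strong
   morphism to a mixed structure L.  Telescoping shows that ker phi is closed
   for the filtration by order, so it is the intersection of the ideals
   ker phi + (series of order >= c), whose quotients are finite dimensional and
   nilpotent: finitely generated mixed structures are residually finite
   dimensional nilpotent.  Uniqueness follows, since positive formulas are
   preserved by morphisms: take J to name x and two solutions y, z; these agree
   in every quotient.
   For existence take the solutions of theta at the generic tuple in the
   quotients Lie<<n>>/(order >= c).  By uniqueness they are compatible, hence
   come from a tuple Y of Lie series.  Some disjunct of theta holds in
   infinitely many quotients, so theta holds at Y, and evaluating at x gives a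
   solution in L. *)
From HB Require Import structures.
From mathcomp Require Import all_boot all_algebra.
From mathcomp Require Import boolp classical_sets.
From mathcomp Require Import finmap functions cardinality fsbigop.
Require Import Defs.

Set Implicit Arguments.
Unset Strict Implicit.
Unset Printing Implicit Defensive.

Import GRing.Theory.

(** * Linear maps and identities in Lie algebras *)

Section LinearAndBracket.
Local Open Scope ring_scope.
Variable k : fieldType.

Lemma linear_exists (U V : lmodType k) (f : U -> V) :
  linear f -> exists g : {linear U -> V}, g =1 f.
Proof.
move=> fl; pose m := GRing.isLinear.Build k U V _ f fl.
by pose g : {linear U -> V} := HB.pack f m; exists g.
Qed.

Lemma bracketBr (L : lieAlgType k) (x y z : L) :
  bracket x (y - z) = bracket x y - bracket x z.
Proof.
have := bracket_linearr x (-1) z y.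
by rewrite !scaleN1r [- z + y]addrC => ->; rewrite addrC.
Qed.

Lemma bracketr0 (L : lieAlgType k) (x : L) : bracket x 0 = 0.
Proof. by rewrite -[X in bracket x X](subrr 0) bracketBr subrr. Qed.

Lemma bracketC (L : lieAlgType k) (x y : L) : bracket y x = - bracket x y.
Proof.
have Dl (a b z : L) : bracket (a + b) z = bracket a z + bracket b z.
  by have := bracket_linearl z 1 a b; rewrite !scale1r.
have Dr (z a b : L) : bracket z (a + b) = bracket z a + bracket z b.
  by have := bracket_linearr z 1 a b; rewrite !scale1r.
apply/eqP; rewrite -addr_eq0; apply/eqP; have := bracketxx (x + y).
by rewrite Dl !Dr !bracketxx add0r addr0 addrC.
Qed.

End LinearAndBracket.

(** * Substitution of series without constant term *)

Section Substitution.
Local Open Scope classical_set_scope.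
Local Open Scope ring_scope.
Variables (k : fieldType) (I : choiceType).

Definition ncmon (v : seq I) : ncseries k I := fun w => (w == v)%:R.

Lemma ncmonM (u v : seq I) : ncmon u * ncmon v = ncmon (u ++ v).
Proof.
elim: u => [|i u IHu]; first exact: mul1r.
apply/funext => -[|j w].
  by rewrite [LHS](ncseries_mul_nil (ncmon (i :: u)) (ncmon v)) mul0r.
rewrite [LHS](ncseries_mul_cons (ncmon (i :: u)) (ncmon v)) mul0r add0r.
have -> : ncseries_lderiv j (ncmon (i :: u)) = (j == i)%:R *: ncmon u.
  apply/funext => x; rewrite /ncseries_lderiv ncseriesZE /ncmon eqseq_cons.
  by rewrite -mulnb natrM.
rewrite -ncseries_mulZl ncseriesZE.
rewrite [X in _ * X](_ : _ = (ncmon u * ncmon v) w)//.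
by rewrite IHu /ncmon eqseq_cons -mulnb natrM.
Qed.

(* Coefficients have type [k^o]; the casts to [k] keep the scaling over [k]. *)
Lemma ncmon_summable (P : ncseries k I) :
  @ncseries_summable k _ _ (fun v => (P v : k) *: ncmon v).
Proof.
move=> w; apply: sub_finite_set (finite_set1 w) => v /=.
rewrite ncseriesZE /ncmon; case: (eqVneq w v) => [->//|_].
by rewrite mulr0 eqxx.
Qed.

Lemma ncmon_sum (P : ncseries k I) :
  @ncseries_sum k _ _ (fun v => (P v : k) *: ncmon v) = P.
Proof.
apply/funext => w; rewrite /ncseries_sum (@fsum_seq _ _ [:: w])//.
  by rewrite big_seq1 ncseriesZE /ncmon eqxx mulr1.
by move=> v; rewrite inE ncseriesZE /ncmon eq_sym => /negPf ->; rewrite mulr0.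
Qed.

Variables (J : choiceType) (A : I -> ncseries k J).

Definition word_prod (v : seq I) : ncseries k J := \prod_(i <- v) A i.

(** The algebra morphism sending each variable [X_i] to [A i]; [sA] and [A0] below make the family
    of scaled word products summable. *)
Definition subst (P : ncseries k I) : ncseries k J :=
  @ncseries_sum k _ _ (fun v => (P v : k) *: word_prod v).

Hypothesis sA : ncseries_summable A.
Hypothesis A0 : forall i, A i [::] = 0.

(** Induction on the length of [w]: as [A i] has no constant term, a nonzero coefficient of
    [A i * word_prod v] at [w] cuts off a nonempty prefix and leaves a shorter word for [v]. Then
    [sA] allows finitely many [i], the induction hypothesis finitely many [v]. *)
Lemma word_prod_summable : ncseries_summable word_prod.
Proof.
move=> w; have [n] := ubnP (size w); elim: n w => // n IHn w wn.
apply: (@sub_finite_set _ _ ([set [::]] `|`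
  \bigcup_(m in [set m : 'I_(size w).+1 | val m != 0%N])
    [set i :: v | i in [set i | A i (take m w) != 0]
                & v in [set v | word_prod v (drop m w) != 0]])); last first.
  rewrite finite_setU; split; first exact: finite_set1.
  apply: bigcup_finite => [|m /= m0]; first exact: finite_finset.
  apply: finite_image2; first exact: sA.
  apply: IHn; rewrite size_drop -ltnS; apply: leq_trans wn.
  by rewrite ltnS ltn_subrL lt0n m0/=; case: (size w) m m0 => [[[]]|].
case=> [|i v] /=; first by left.
rewrite /word_prod big_cons ncseriesME => sum_neq0; right.
have [m Am] : exists m : 'I_(size w).+1,
    A i (take m w) * word_prod v (drop m w) != 0.
  apply/existsP; apply: contraNT sum_neq0 => /existsPn h.
  by apply/eqP; apply: big1 => m _; apply/eqP; have := h m; rewrite negbK.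
have m0 : val m != 0%N.
  by apply: contra_neq Am => /= ->; rewrite take0 A0 mul0r.
exists m => //; exists i => /=.
  by apply: contra_neq Am => ->; rewrite mul0r.
by exists v => //=; apply: contra_neq Am => E; rewrite [word_prod v _]E mulr0.
Qed.

Lemma subst_summable (P : ncseries k I) :
  @ncseries_summable k _ _ (fun v => (P v : k) *: word_prod v).
Proof.
move=> w; apply: sub_finite_set (word_prod_summable w) => v /=.
by apply: contra_neq; rewrite ncseriesZE => ->; rewrite mulr0.
Qed.

(** The list [r] is chosen before [P]: a coefficient of [subst P] is a fixed finite linear
    combination of coefficients of [P]. *)
Lemma substE w : exists2 r : seq (seq I), uniq r &
  forall P, subst P w = \sum_(v <- r) P v * word_prod v w.
Proof.
have [r r_uniq r0] := finite_suppP (word_prod_summable w).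
exists r => // P; rewrite /subst /ncseries_sum (fsum_seq r_uniq)// => v /r0 E.
by rewrite ncseriesZE E mulr0.
Qed.

Lemma subst_linear : linear subst.
Proof.
move=> c P Q; apply/funext => w; have [r _ rE] := substE w.
rewrite ncseriesDE ncseriesZE !rE mulr_sumr -big_split/=.
by apply: eq_bigr => v _; rewrite mulrDl mulrA.
Qed.

Lemma subst_strong (X : choiceType) (P : X -> ncseries k I) :
  ncseries_summable P ->
  ncseries_summable (subst \o P) /\
  ncseries_sum (subst \o P) = subst (ncseries_sum P).
Proof.
move=> sP.
(* The coefficient at [w] sees only the words of [r], each in the support of finitely many [P x];
   [s] collects these [x], so both sums become finite and can be exchanged. *)
have cover w : exists (r : seq (seq I)) (s : seq X), [/\ uniq s,
    forall Q, subst Q w = \sum_(v <- r) Q v * word_prod v w &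
    forall x, x \notin s -> forall v, v \in r -> P x v = 0].
  have [r _ rE] := substE w.
  have : finite_set (\bigcup_(v in [set` r]) [set x | P x v != 0]).
    by apply: bigcup_finite => // v _; exact: sP.
  move=> /finite_fsetP[s sE]; exists r, s; split=> // x xs v vr.
  apply: contraNeq xs => Px.
  have : (\bigcup_(v in [set` r]) [set x | P x v != 0]) x by exists v.
  by rewrite sE.
have zero w r (s : seq X) :
    (forall Q, subst Q w = \sum_(v <- r) Q v * word_prod v w) ->
    (forall x, x \notin s -> forall v, v \in r -> P x v = 0) ->
    forall x, x \notin s -> subst (P x) w = 0.
  move=> rE s0 x /s0 xs; rewrite rE big_seq big1// => v /xs ->.
  by rewrite mul0r.
split=> [w|].
  have [r [s [_ rE s0]]] := cover w.
  apply: sub_finite_set (finite_seq s) => x /=.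
  by apply: contraR => /(zero w r s rE s0)/eqP.
apply/funext => w; have [r [s [s_uniq rE s0]]] := cover w.
rewrite {1}/ncseries_sum (fsum_seq s_uniq (zero w r s rE s0)) rE /=.
rewrite (eq_bigr _ (fun x _ => rE (P x))) exchange_big/= big_seq [RHS]big_seq.
apply: eq_bigr => v vr; rewrite -mulr_suml; congr (_ * _).
by rewrite /ncseries_sum (fsum_seq s_uniq)// => x /s0; apply.
Qed.

Lemma subst_mon v : subst (ncmon v) = word_prod v.
Proof.
apply/funext => w; rewrite /subst /ncseries_sum (@fsum_seq _ _ [:: v])//.
  by rewrite big_seq1 ncseriesZE /ncmon eqxx mul1r.
by move=> u; rewrite inE ncseriesZE /ncmon => /negPf ->; rewrite mul0r.
Qed.

(* Both sides are sums over pairs of words, so strong linearity reduces the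
   claim to monomials. *)
Lemma substM P Q : subst (P * Q) = subst P * subst Q.
Proof.
have [sPQ PQE] := ncseries_mul_sum (ncmon_summable P) (ncmon_summable Q).
rewrite !ncmon_sum in PQE; rewrite -PQE.
have [_ <-] := subst_strong sPQ.
have [_ <-] := ncseries_mul_sum (subst_summable P) (subst_summable Q).
congr ncseries_sum; apply/funext => -[u v] /=.
have substZ c R : subst (c *: R) = c *: subst R.
  by have [f fE] := linear_exists subst_linear; rewrite -!fE linearZ.
rewrite -!scalerAl -!scalerAr !scalerA substZ ncmonM subst_mon.
rewrite /word_prod big_cat.
by [].
Qed.

Lemma subst_var i : subst (ncvar k i) = A i.
Proof. by have := subst_mon [:: i]; rewrite /word_prod big_seq1. Qed.

End Substitution.

(** * Evaluations of Lie series at Lie series *)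

Section LieEvaluations.
Local Open Scope classical_set_scope.
Local Open Scope ring_scope.
Variable k : fieldType.

Lemma lieseries_ind_set (I : choiceType) (E : set (ncseries k I)) :
  summability_subalgebra E -> (forall i, E (ncvar k i)) ->
  forall P : lieseries k I, E (val P).
Proof.
move=> Esub EX P; have /set_mem := lieseriesP P; apply: smallest_sub => //.
by move=> _ [i _ <-].
Qed.

(** Vanishing constant terms survive commutators and sums. This is what allows Lie series to be
    substituted for variables. *)
Lemma lieseries_nil (I : choiceType) (P : lieseries k I) :
  lieseries_val P [::] = 0.
Proof.
pose E : set (ncseries k I) := [set Q | Q [::] = 0].
apply: (@lieseries_ind_set I E) => //; split.
- split=> [|c Q R /set_mem/= Q0 /set_mem/= R0]; apply/mem_set => //=.
  by rewrite /E/= ncseriesDE ncseriesZE Q0 R0 mulr0 addr0.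
- move=> Q R /set_mem/= Q0 /set_mem/= R0; apply/mem_set => /=.
  have M0 (S T : ncseries k I) : S [::] = 0 -> (S * T) [::] = 0.
    by move=> S0; rewrite [LHS](ncseries_mul_nil S T) S0 mul0r.
  rewrite /E/= /bracket/= /ncseries_bracket ncseriesDE M0// add0r.
  by rewrite -scaleN1r ncseriesZE M0// mulr0.
- move=> X v _ v0; apply/mem_set; apply: fsbig1 => x _.
  exact: set_mem (v0 x).
Qed.

Lemma summability_subalgebra_preimage (L M : summLieType k) (f : L -> M)
    (A : set M) :
  linear f -> (forall x y, f (bracket x y) = bracket (f x) (f y)) ->
  (forall (X : choiceType) (v : X -> L), summable v ->
    summable (f \o v) /\ ssum (f \o v) = f (ssum v)) ->
  summability_subalgebra A -> summability_subalgebra (f @^-1` A).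
Proof.
move=> fl fB fS [[A0 AD] AB AS].
have f0 : f 0 = 0.
  by have [g gE] := linear_exists fl; rewrite -gE linear0.
split.
- split=> [|c x y /set_mem xA /set_mem yA]; apply/mem_set => /=.
    by rewrite f0; apply/set_mem.
  by rewrite fl; apply/set_mem/AD; apply/mem_set.
- move=> x y /set_mem xA /set_mem yA; apply/mem_set => /=.
  by rewrite fB; apply/set_mem/AB; apply/mem_set.
- move=> X v sv vA; apply/mem_set => /=.
  have [sfv <-] := fS _ _ sv; exact/set_mem/AS.
Qed.

Lemma lieseries_has_evaluations (J : choiceType) :
  has_evaluations (lieseries k J).
Proof.
move=> I a sa; pose A i := lieseries_val (a i).
have sA : ncseries_summable A by exact: sa.
have A0 i : A i [::] = 0 by exact: lieseries_nil.
have sl := subst_linear sA A0.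
have sB (P Q : ncseries k I) :
    subst A (bracket P Q) = bracket (subst A P) (subst A Q).
  rewrite /bracket/= /ncseries_bracket -!(substM sA A0) addrC -scaleN1r sl.
  by rewrite scaleN1r addrC.
have lieA P : subst A (lieseries_val P) \in @lie_pred k J.
  (* The series that [subst A] sends to Lie series form a summability subalgebra containing the
     variables, hence include all Lie series. *)
  apply/mem_set; apply: (@lieseries_ind_set _ (subst A @^-1` lie_set (I:=J))).
    apply: summability_subalgebra_preimage sl sB _ (lie_set_subalgebra _ _).
    exact: (subst_strong sA A0).
  by move=> i /=; rewrite subst_var//; apply/set_mem/lieseriesP.
have fl : linear (fun P => LieSeries (lieA P)).
  by move=> c P Q; apply: val_inj; exact: sl.
have [ev evE] := linear_exists fl.
have evf : ev = (fun P => LieSeries (lieA P)) :> (_ -> _) by exact/funext.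
exists ev; split.
- by move=> P Q; rewrite !evE; apply: val_inj; exact: sB.
- move=> X v sv; have [sv' svE] := subst_strong sA A0 sv.
  rewrite evf; split=> //; apply: val_inj; rewrite lie_sumE//.
  by rewrite /= lie_sumE.
- by move=> i; rewrite evE; apply: val_inj; rewrite /= subst_var.
Qed.

HB.instance Definition _ (J : choiceType) :=
  SummabilityLie_isMixed.Build k (lieseries k J)
    (@lieseries_has_evaluations J).

End LieEvaluations.

(** * Finite dimensional quotients as mixed structures *)

Section DiscreteQuotient.
Local Open Scope classical_set_scope.
Local Open Scope ring_scope.
Variable k : fieldType.

Lemma evaluation_comp (L M : summLieType k) (f : {linear L -> M})
    (I : choiceType) (a : I -> L) (ev : {linear lieseries k I -> L}) :
  lie_morphism f -> strongly_linear f -> is_evaluation a ev ->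
  is_evaluation (f \o a) (f \o ev).
Proof.
move=> fB fS [evB evS evX]; split.
- by move=> x y; rewrite /= evB fB.
- move=> X v sv; have [sev evE] := evS _ _ sv.
  by have [sfev fevE] := fS _ _ sev; split=> //=; rewrite -evE -fevE.
- by move=> i; rewrite /= evX.
Qed.

(* A finite dimensional quotient of [L] by a strong ideal, given in coordinates
   together with a linear section; by [dq_strong] the discrete summability
   structure of the quotient makes the projection strongly linear. *)
Record discrete_quotient (L : mixedType k) := DiscreteQuotient {
  dq_dim : nat;
  dq_proj : {linear L -> 'rV[k]_dq_dim};
  dq_sec : {linear 'rV[k]_dq_dim -> L};
  dq_secK : cancel dq_sec dq_proj;
  dq_ideal : forall x y, dq_proj y = 0 -> dq_proj (bracket x y) = 0;
  dq_strong : forall (I : choiceType) (v : I -> L), summable v ->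
    finite_set [set i | dq_proj (v i) != 0] /\
    dq_proj (ssum v) = \sum_(i \in [set: I]) dq_proj (v i) }.

Variables (L : mixedType k) (q : discrete_quotient L).

Definition quot : Type := 'rV[k]_(dq_dim q).

HB.instance Definition _ := GRing.Lmodule.on quot.

Local Notation proj := (dq_proj q : L -> quot).
Local Notation sec := (dq_sec q : quot -> L).

Definition quot_bracket (u v : quot) : quot := proj (bracket (sec u) (sec v)).

(** By [dq_ideal] the second argument matters only modulo the kernel, and antisymmetry carries this
    over to the first. *)
Lemma quot_bracketE x y : proj (bracket x y) = quot_bracket (proj x) (proj y).
Proof.
have idealr (a b b' : L) : proj b = proj b' ->
    proj (bracket a b) = proj (bracket a b').
  move=> bb'; apply/eqP; rewrite -subr_eq0 -linearB/=; apply/eqP.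
  rewrite -bracketBr; apply: dq_ideal.
  by rewrite linearB/= [X in X - _]bb' subrr.
have secE b : proj b = proj (sec (proj b)) by rewrite [RHS]dq_secK.
rewrite /quot_bracket (idealr _ _ _ (secE y)) bracketC linearN/=.
by rewrite (idealr _ _ _ (secE x)) -linearN -bracketC.
Qed.

Lemma quot_bracket_linearl z : linear (quot_bracket^~ z).
Proof.
by move=> c u v; rewrite /quot_bracket linearP bracket_linearl linearP.
Qed.

Lemma quot_bracket_linearr z : linear (quot_bracket z).
Proof.
by move=> c u v; rewrite /quot_bracket linearP bracket_linearr linearP.
Qed.

Lemma quot_bracketxx u : quot_bracket u u = 0.
Proof. by rewrite /quot_bracket bracketxx linear0. Qed.

Lemma quot_jacobi u v w :
  quot_bracket u (quot_bracket v w) + quot_bracket v (quot_bracket w u)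
    + quot_bracket w (quot_bracket u v) = 0.
Proof.
have -> : u = proj (sec u) by rewrite [RHS]dq_secK.
have -> : v = proj (sec v) by rewrite [RHS]dq_secK.
have -> : w = proj (sec w) by rewrite [RHS]dq_secK.
by rewrite -!quot_bracketE -!linearD/= jacobi linear0.
Qed.

HB.instance Definition _ := Lmodule_isLieAlgebra.Build k quot
  quot_bracket_linearl quot_bracket_linearr quot_bracketxx quot_jacobi.

Definition quot_summable (I : choiceType) : set (I -> quot) :=
  [set v | finite_set [set i | v i != 0]].

(** Summing in [L] lets the axioms descend from [L]; by [quot_SM1] the result is the ordinary finite
    sum. *)
Definition quot_sum (I : choiceType) (v : I -> quot) : quot :=
  proj (ssum (fun i => sec (v i))).

Lemma quot_summable_sec (I : choiceType) (v : I -> quot) :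
  quot_summable v -> summable (fun i => sec (v i)).
Proof.
move=> sv; apply: (SM1 _ _ _).1; apply: sub_finite_set sv => i /=.
by apply: contra_neq => ->; rewrite linear0.
Qed.

Lemma quot_summable_proj (I : choiceType) (v : I -> L) :
  summable v -> quot_summable (fun i => proj (v i)).
Proof. by move=> /(dq_strong q)[]. Qed.

Lemma quot_sum_proj (I : choiceType) (v : I -> L) :
  summable v -> quot_sum (fun i => proj (v i)) = proj (ssum v).
Proof.
move=> sv; have sv' := quot_summable_sec (quot_summable_proj sv).
have [_ E] := dq_strong q sv; have [_ E'] := dq_strong q sv'.
rewrite /quot_sum [LHS]E' [RHS]E; apply: eq_fsbigr => i _.
by rewrite dq_secK.
Qed.

(** Reduces statements about summable families of the quotient to the same statements in [L]. *)
Lemma quot_lift (I : choiceType) (v : I -> quot) :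
  quot_summable v ->
  exists2 w : I -> L, summable w & v = (fun i => proj (w i)).
Proof.
move=> sv; exists (fun i => sec (v i)); first exact: quot_summable_sec.
by apply/funext => i; rewrite [RHS]dq_secK.
Qed.

Lemma quot_summable_linear (I : choiceType) (c : k) (v w : I -> quot) :
  quot_summable v -> quot_summable w ->
  quot_summable (fun i => c *: v i + w i).
Proof.
move=> /quot_lift[v' sv ->] /quot_lift[w' sw ->].
have := quot_summable_proj (summable_linear _ c _ _ sv sw).
by congr quot_summable; apply/funext => i; rewrite linearP.
Qed.

Lemma quot_sum_linear (I : choiceType) (c : k) (v w : I -> quot) :
  quot_summable v -> quot_summable w ->
  quot_sum (fun i => c *: v i + w i) = c *: quot_sum v + quot_sum w.
Proof.
move=> /quot_lift[v' sv ->] /quot_lift[w' sw ->].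
rewrite !quot_sum_proj// -linearP -ssum_linear//.
rewrite -quot_sum_proj; last exact: summable_linear.
by congr quot_sum; apply/funext => i; rewrite linearP.
Qed.

Lemma quot_SM1 (I : choiceType) (v : I -> quot) :
  finite_set [set i | v i != 0] ->
  quot_summable v /\ quot_sum v = \sum_(i \in [set: I]) v i.
Proof.
move=> sv; split=> //; have [_ E] := dq_strong q (quot_summable_sec sv).
by rewrite /quot_sum [LHS]E; apply: eq_fsbigr => i _; rewrite dq_secK.
Qed.

Lemma quot_SM2 (I J : choiceType) (phi : I -> J) (v : J -> quot) :
  bijective phi -> quot_summable v ->
  quot_summable (v \o phi) /\ quot_sum (v \o phi) = quot_sum v.
Proof.
move=> phi_bij /quot_lift[w sw ->].
have [sw' E] := SM2 _ _ _ _ phi_bij sw.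
split; first exact: (quot_summable_proj sw').
by rewrite quot_sum_proj// -E; exact: (quot_sum_proj sw').
Qed.

Lemma quot_SM3 (I J : choiceType) (p : I -> J) (v : I -> quot) :
  quot_summable v ->
  [/\ forall j, quot_summable (fun i : {i | p i == j} => v (val i)),
      quot_summable (fun j => quot_sum (fun i : {i | p i == j} => v (val i)))
    & quot_sum (fun j => quot_sum (fun i : {i | p i == j} => v (val i)))
      = quot_sum v].
Proof.
move=> /quot_lift[w sw ->]; have [sfib ssfib E] := SM3 _ _ p _ sw.
have fibE : (fun j => quot_sum (fun i : {i | p i == j} => proj (w (val i))))
    = (fun j => proj (ssum (fun i : {i | p i == j} => w (val i)))).
  by apply/funext => j; exact: (quot_sum_proj (sfib j)).
rewrite fibE; split=> [j||]; last by rewrite !quot_sum_proj// E.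
  exact: (quot_summable_proj (sfib j)).
exact: quot_summable_proj.
Qed.

Lemma quot_SM4 (I J : choiceType) (v : I -> quot) (w : J -> quot) :
  quot_summable v -> quot_summable w ->
  @quot_summable (I + J)%type
    (fun u => match u with inl i => v i | inr j => w j end).
Proof.
move=> /quot_lift[v' sv ->] /quot_lift[w' sw ->].
have := quot_summable_proj (SM4 _ _ _ _ sv sw).
by congr quot_summable; apply/funext => -[].
Qed.

Lemma quot_SM5 (I : choiceType) (v : I -> quot) (X : I -> finType)
    (f : forall i, X i -> k) :
  quot_summable v ->
  @quot_summable {i : I & X i} (fun u => f (tag u) (tagged u) *: v (tag u)).
Proof.
move=> /quot_lift[w sw ->]; have := quot_summable_proj (SM5 _ _ X f sw).
by congr quot_summable; apply/funext => u; rewrite linearZ.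
Qed.

HB.instance Definition _ := Lmodule_isSummability.Build k quot
  quot_summable_linear quot_sum_linear quot_SM1 quot_SM2 quot_SM3 quot_SM4
  quot_SM5.

Lemma quot_bracket_ssum (I J : choiceType) (a : I -> quot) (b : J -> quot) :
  summable a -> summable b ->
  summable (fun ij : I * J => bracket (a ij.1) (b ij.2)) /\
  ssum (fun ij : I * J => bracket (a ij.1) (b ij.2))
  = bracket (ssum a) (ssum b).
Proof.
move=> /quot_lift[v sv ->] /quot_lift[w sw ->].
have [svw E] := bracket_ssum _ _ _ _ sv sw.
have bE : (fun ij : I * J => bracket (proj (v ij.1)) (proj (w ij.2)))
    = (fun ij => proj (bracket (v ij.1) (w ij.2))).
  by apply/funext => ij; rewrite quot_bracketE.
rewrite bE; split; first exact: quot_summable_proj.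
rewrite [LHS](quot_sum_proj svw) E quot_bracketE.
by rewrite -(quot_sum_proj sv) -(quot_sum_proj sw).
Qed.

HB.instance Definition _ :=
  LieSummability_isSummabilityLie.Build k quot quot_bracket_ssum.

Definition quot_proj : {linear L -> quot} := dq_proj q.

Lemma quot_proj_lie : lie_morphism quot_proj.
Proof. exact: quot_bracketE. Qed.

Lemma quot_proj_strong : strongly_linear quot_proj.
Proof.
move=> I v sv; split; first exact: quot_summable_proj.
exact: quot_sum_proj.
Qed.

Lemma quot_has_evaluations : has_evaluations quot.
Proof.
move=> I a /quot_lift[b sb ->].
have [ev evP] := mixed_evaluations I b sb.
by exists (quot_proj \o ev);
  apply: evaluation_comp quot_proj_lie quot_proj_strong _.
Qed.

HB.instance Definition _ :=
  SummabilityLie_isMixed.Build k quot quot_has_evaluations.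

End DiscreteQuotient.

(** * Coordinates modulo a subspace of finite codimension *)

Section CoordinatesModuloSubspace.
Local Open Scope classical_set_scope.
Local Open Scope ring_scope.
Variables (k : fieldType) (V : lmodType k) (H : set V).
Hypothesis H0 : H 0.
Hypothesis H_linear : forall (c : k) x y, H x -> H y -> H (c *: x + y).

Definition lin_comb (d : nat) (b : 'I_d -> V) (c : 'rV[k]_d) : V :=
  \sum_i c 0 i *: b i.

Lemma lin_comb_linear (d : nat) (b : 'I_d -> V) : linear (lin_comb b).
Proof.
move=> a u v; rewrite /lin_comb scaler_sumr -big_split/=.
by apply: eq_bigr => i _; rewrite !mxE scalerDl scalerA.
Qed.

Definition independent_mod (d : nat) (b : 'I_d -> V) : Prop :=
  forall c, H (lin_comb b c) -> c = 0.

(** As the kernel of [tau] lies in [H], the vectors [tau (b i)] are linearly independent in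
    dimension [D]. *)
Lemma independent_mod_leq (D : nat) (tau : {linear V -> 'rV[k]_D})
    (d : nat) (b : 'I_d -> V) :
  (forall x, tau x = 0 -> H x) -> independent_mod b -> (d <= D)%N.
Proof.
move=> tauH b_indep; pose M := \matrix_(i < d) tau (b i).
suff /eqP <- : row_free M by exact: rank_leq_col.
rewrite -kermx_eq0; apply/rowV0P => c /sub_kermxP cM; apply: b_indep.
apply: tauH; rewrite linear_sum/= -[RHS]cM mulmx_sum_row; apply: eq_bigr => i _.
by rewrite linearZ rowK.
Qed.

Lemma maximal_independent_mod (d : nat) (b : 'I_d -> V) :
  independent_mod b ->
  (forall b' : 'I_d.+1 -> V, ~ independent_mod b') ->
  forall x, exists c, H (x - lin_comb b c).
Proof.
move=> b_indep b_max x; pose b' i := oapp b x (unlift ord0 i).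
have [c [Hc c_neq0]] : exists c, H (lin_comb b' c) /\ c != 0.
  apply: contrapT => nc; apply: (b_max b') => c Hc; apply: contrapT => c0.
  by apply: nc; exists c; split=> //; apply/eqP.
pose u : 'rV_d := \row_i c 0 (lift ord0 i).
have combE : lin_comb b' c = c 0 0 *: x + lin_comb b u.
  rewrite /lin_comb big_ord_recl /b' unlift_none; congr (_ + _).
  by apply: eq_bigr => i _; rewrite liftK mxE.
(* Otherwise the nontrivial relation would involve [b] alone; so it can be solved for [x]. *)
have c0 : c 0 0 != 0.
  apply: contra_neq c_neq0 => c0; move: Hc.
  rewrite combE c0 scale0r add0r => /b_indep u0; apply/rowP => i; rewrite mxE.
  have [j ->|->//] := unliftP ord0 i.
  by have /rowP/(_ j) := u0; rewrite !mxE.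
exists (- (c 0 0)^-1 *: u).
have := H_linear (c 0 0)^-1 Hc H0; rewrite addr0 combE scalerDr scalerA mulVf//.
have := lin_comb_linear b (- (c 0 0)^-1) u 0; rewrite addr0 => ->.
have -> : lin_comb b 0 = 0 by apply: big1 => i _; rewrite mxE scale0r.
by rewrite scale1r addr0 scaleNr opprK.
Qed.

(** [tau] bounds the size of families independent modulo [H], so a maximal one [b] exists and
    represents a basis of [V/H]. The section is [lin_comb b], and [pi x] is the unique [c] with
    [x - lin_comb b c] in [H]. *)
Lemma coordinates_mod (D : nat) (tau : {linear V -> 'rV[k]_D}) :
  (forall x, tau x = 0 -> H x) ->
  exists (d : nat) (pi : {linear V -> 'rV[k]_d}) (s : {linear 'rV[k]_d -> V}),
    cancel s pi /\ forall x, pi x = 0 <-> H x.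
Proof.
move=> tauH.
pose has_indep d := `[< exists b : 'I_d -> V, independent_mod b >].
have ex_indep : exists d, has_indep d.
  exists 0%N; apply/asboolP; exists (fun=> 0) => c _.
  exact: thinmx0.
have bound d : has_indep d -> (d <= D)%N.
  by move=> /asboolP[b]; exact: (independent_mod_leq tauH).
have [d /asboolP[b b_indep] d_max] := ex_maxnP ex_indep bound.
have b_max (b' : 'I_d.+1 -> V) : ~ independent_mod b'.
  move=> b'_indep; have /d_max : has_indep d.+1 by apply/asboolP; exists b'.
  by rewrite ltnn.
have [f fP] := boolp.choice (maximal_independent_mod b_indep b_max).
have [s sE] := linear_exists (lin_comb_linear b).
have sub_H x y : H x -> H y -> H (x - y).
  by move=> Hx Hy; have := H_linear (-1) Hy Hx; rewrite scaleN1r addrC.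
have f_uniq x c : H (x - s c) -> f x = c.
  move=> Hxc; apply/eqP; rewrite -subr_eq0; apply/eqP/b_indep.
  rewrite -sE linearB/= !sE; have := sub_H _ _ Hxc (fP x).
  by rewrite sE opprB addrC addrA subrK addrC.
have fl : linear f.
  move=> a x y; apply: f_uniq; rewrite linearP !sE.
  have := H_linear a (fP x) (fP y).
  by rewrite scalerBr addrACA -opprD.
have [pi piE] := linear_exists fl; exists d, pi, s; split=> [c|x].
  by rewrite piE; apply: f_uniq; rewrite subrr.
split=> [x0|Hx]; first by have := fP x; rewrite -piE x0 -sE linear0 subr0.
by rewrite piE; apply: f_uniq; rewrite linear0 subr0.
Qed.

End CoordinatesModuloSubspace.

(** * The filtration by order and its nilpotent quotients *)

Section Truncation.
Local Open Scope classical_set_scope.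
Local Open Scope ring_scope.
Variable k : fieldType.

Definition lie_order (I : choiceType) (c : nat) (P : lieseries k I) : Prop :=
  forall w, (size w < c)%N -> lieseries_val P w = 0.

Section Order.
Variable I : choiceType.
Implicit Types P Q : lieseries k I.

Lemma lie_order1 P : lie_order 1 P.
Proof. by case=> // _; exact: lieseries_nil. Qed.

Lemma lie_order_leq (c d : nat) P :
  (c <= d)%N -> lie_order d P -> lie_order c P.
Proof. by move=> cd oP w wc; apply: oP; exact: leq_trans cd. Qed.

Lemma lie_order_linear (c : nat) (a : k) P Q :
  lie_order c P -> lie_order c Q -> lie_order c (a *: P + Q).
Proof.
move=> oP oQ w wc.
rewrite [LHS](_ : _ = a * lieseries_val P w + lieseries_val Q w)//.
by rewrite oP// oQ// mulr0 addr0.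
Qed.

Lemma lie_order0 (c : nat) : lie_order c (0 : lieseries k I).
Proof. by []. Qed.

Lemma lie_orderD (c : nat) P Q :
  lie_order c P -> lie_order c Q -> lie_order c (P + Q).
Proof. by move=> oP oQ; have := lie_order_linear 1 oP oQ; rewrite scale1r. Qed.

Lemma lie_orderN (c : nat) P : lie_order c P -> lie_order c (- P).
Proof.
move=> oP; have := lie_order_linear (-1) oP (@lie_order0 c).
by rewrite scaleN1r addr0.
Qed.

Lemma lie_orderB (c : nat) P Q :
  lie_order c P -> lie_order c Q -> lie_order c (P - Q).
Proof. by move=> oP /lie_orderN; exact: lie_orderD. Qed.

Lemma lie_order_bracket (c d : nat) P Q :
  lie_order c P -> lie_order d Q -> lie_order (c + d) (bracket P Q).
Proof.
have mul_order (a b : nat) (R S : ncseries k I) w :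
    (forall v, (size v < a)%N -> R v = 0) ->
    (forall v, (size v < b)%N -> S v = 0) ->
    (size w < a + b)%N -> (R * S) w = 0.
  move=> oR oS wab; rewrite ncseriesME big1// => n _.
  (* A word shorter than [a + b] has no cut with prefix of length at least [a] and suffix of length
     at least [b]. *)
  have [na|an] := ltnP n a.
    rewrite oR ?mul0r//; apply: leq_ltn_trans na.
    by rewrite size_take_min geq_minl.
  rewrite oS ?mulr0// size_drop ltn_subLR; last by rewrite -ltnS.
  by apply: leq_trans wab _; rewrite leq_add2r.
move=> oP oQ w wcd; rewrite [LHS](_ : _ = (lieseries_val P * lieseries_val Q) w
  - (lieseries_val Q * lieseries_val P) w)//.
by rewrite (mul_order c d)// (mul_order d c) ?subrr// addnC.
Qed.

Lemma lie_order_eq0 P : (forall c, lie_order c P) -> P = 0.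
Proof.
by move=> oP; apply: val_inj; apply/funext => w; exact: (oP (size w).+1).
Qed.

End Order.

Section QuotientOfFiniteRank.
Variables (J : finType) (L : summLieType k).
Variable phi : {linear lieseries k J -> L}.
Hypothesis phiB : lie_morphism phi.

(** The ideal [ker phi] plus the series of order at least [c]; for [phi] the identity it is
    [lie_order c]. *)
Definition ker_order (c : nat) (P : lieseries k J) : Prop :=
  exists Q, phi Q = 0 /\ lie_order c (P - Q).

Lemma ker_order_of_order (c : nat) P : lie_order c P -> ker_order c P.
Proof. by move=> oP; exists 0; rewrite linear0 subr0. Qed.

Lemma ker_order_of_ker (c : nat) P : phi P = 0 -> ker_order c P.
Proof. by move=> P0; exists P; rewrite subrr. Qed.

Lemma ker_order_linear (c : nat) (a : k) P Q :
  ker_order c P -> ker_order c Q -> ker_order c (a *: P + Q).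
Proof.
move=> [P' [P0 oP]] [Q' [Q0 oQ]]; exists (a *: P' + Q').
rewrite linearP P0 Q0 scaler0 addr0; split=> //.
by rewrite opprD addrACA -scalerBr; exact: lie_order_linear.
Qed.

Lemma ker_order_bracket (c : nat) P Q :
  ker_order c Q -> ker_order c (bracket P Q).
Proof.
move=> [Q' [Q0 oQ]]; exists (bracket P Q'); split.
  by rewrite phiB Q0 bracketr0.
rewrite -bracketBr; have := lie_order_bracket (lie_order1 P) oQ.
exact: lie_order_leq.
Qed.

Definition short_word (c : nat) : finType := {n : 'I_c & n.-tuple J}.

Definition word_of (c : nat) (x : short_word c) : seq J := tagged x.

Lemma word_of_surj (c : nat) (w : seq J) :
  (size w < c)%N -> exists x : short_word c, word_of x = w.
Proof.
move=> wc; exists (Tagged (fun n : 'I_c => n.-tuple J)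
  (in_tuple w : (Ordinal wc).-tuple J)).
by [].
Qed.

Definition short_coefs (c : nat) (P : lieseries k J) : 'rV[k]_#|short_word c| :=
  \row_i lieseries_val P (word_of (enum_val i)).

Lemma short_coefs_linear (c : nat) : linear (short_coefs c).
Proof. by move=> a P Q; apply/rowP => i; rewrite !mxE. Qed.

Lemma short_coefs_eq0 (c : nat) P : short_coefs c P = 0 <-> lie_order c P.
Proof.
split=> [/rowP P0 w wc|oP].
  have [x <-] := word_of_surj wc.
  by have := P0 (enum_rank x); rewrite !mxE enum_rankK.
by apply/rowP => i; rewrite !mxE; apply: oP; rewrite size_tuple.
Qed.

(** As [J] is finite, there are finitely many short words. Their coefficients give a linear map to a
    finite dimensional space with kernel inside [ker_order c], so [coordinates_mod] applies. *)
Lemma truncation_quotient (c : nat) :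
  exists q : discrete_quotient (lieseries k J),
    forall P, dq_proj q P = 0 <-> ker_order c P.
Proof.
have [tau tauE] := linear_exists (@short_coefs_linear c).
have tau0 P : tau P = 0 <-> lie_order c P.
  by rewrite tauE; exact: short_coefs_eq0.
have [d [pi [s [sK piE]]]] := coordinates_mod (H := ker_order c)
  (ker_order_of_order (@lie_order0 _ _)) (@ker_order_linear c)
  (fun P P0 => ker_order_of_order ((tau0 P).1 P0)).
have ideal P Q : pi Q = 0 -> pi (bracket P Q) = 0.
  by move=> /piE; move=> Q0; apply/piE; exact: ker_order_bracket.
suff strong (I : choiceType) (v : I -> lieseries k J) : summable v ->
    finite_set [set i | pi (v i) != 0] /\
    pi (ssum v) = \sum_(i \in [set: I]) pi (v i).
  by exists (DiscreteQuotient sK ideal strong).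
move=> sv.
(* Only finitely many [v i] are nonzero at some short word; all others have order at least [c] and
   die in the quotient. *)
have : finite_set (\bigcup_(x in [set: short_word c])
    [set i | lieseries_val (v i) (word_of x) != 0]).
  by apply: bigcup_finite => [|x _]; [exact: finite_finset|exact: sv].
move=> /finite_fsetP[r rE].
have v0 i : i \notin (r : seq I) -> lie_order c (v i).
  move=> ir w wc; apply: contraNeq ir => vw.
  suff : [set` r] i by [].
  by rewrite -rE; have [x xE] := word_of_surj wc; exists x => //=; rewrite xE.
have pi0 i : i \notin (r : seq I) -> pi (v i) = 0.
  by move=> /v0 oi; apply/piE; exact: ker_order_of_order.
split.
  apply: sub_finite_set (finite_seq r) => i /=.
  by apply: contraR => /pi0/eqP.
rewrite (fsum_seq (fset_uniq r) pi0) -linear_sum/=.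
(* The full sum and the partial sum over [r] agree at short words. *)
apply/eqP; rewrite -subr_eq0 -linearB/=; apply/eqP/piE/ker_order_of_order.
move=> w wc; rewrite [LHS](_ : _ = lieseries_val (ssum v) w
  - lieseries_val (\sum_(i <- r) v i) w)//.
rewrite [lieseries_val (ssum v)](lie_sumE sv).
rewrite [X in X - _](@fsum_seq _ _ r)//; last by move=> i /v0; apply.
apply/eqP; rewrite subr_eq0; apply/eqP; elim: (r : seq I) => [|i t IHt].
  by rewrite !big_nil.
by rewrite !big_cons IHt.
Qed.

Lemma truncation_nilpotent (c : nat) (q : discrete_quotient (lieseries k J)) :
  (forall P, dq_proj q P = 0 <-> ker_order c P) -> lie_nilpotent (quot q).
Proof.
move=> qE.
(* The index is [j.+1] because Lie series have no constant term: term [0], the whole algebra,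
   already starts at order one, and each bracket adds at least one. *)
have lcs j : lower_central (quot q) j `<=`
    [set u | exists2 P, lie_order j.+1 P & quot_proj q P = u].
  elim: j => [|j IHj] u.
    by move=> _; exists (dq_sec q u); [exact: lie_order1|exact: dq_secK].
  apply: smallest_sub => [|_ [x _ [y /IHj[Q oQ <-] <-]]].
    split=> [|a x y /set_mem[P oP <-] /set_mem[Q oQ <-]]; apply/mem_set.
      by exists 0; rewrite ?linear0//; exact: lie_order0.
    by exists (a *: P + Q); [exact: lie_order_linear|rewrite linearP].
  exists (bracket (dq_sec q x) Q).
    exact: lie_order_bracket (lie_order1 _) oQ.
  by rewrite quot_proj_lie; congr bracket; exact: dq_secK.
exists c; apply/seteqP; split=> [u /lcs[P oP <-]|_ ->].
  by apply/qE/ker_order_of_order; exact: lie_order_leq oP.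
case: c {qE} => // c A [[A0 _] _]; exact: set_mem A0.
Qed.

End QuotientOfFiniteRank.
End Truncation.

(** * Limits of Lie series and closed kernels *)

Section Closedness.
Local Open Scope classical_set_scope.
Local Open Scope ring_scope.
Variable k : fieldType.

(** Completeness for the order filtration: at a word shorter than [c] only the first [c] differences
    contribute, and they telescope to [Q c - Q 0]. *)
Lemma lie_limit (I : choiceType) (Q : nat -> lieseries k I) :
  (forall c, lie_order c (Q c.+1 - Q c)) ->
  summable (fun c => Q c.+1 - Q c) /\
  forall c, lie_order c (Q 0%N + ssum (fun c => Q c.+1 - Q c) - Q c).
Proof.
move=> oD; pose D c := Q c.+1 - Q c.
have sD : summable D.
  move=> w; apply: sub_finite_set (finite_II (size w).+1) => c /=.
  by apply: contraR; rewrite -leqNgt => wc; apply/eqP; apply: oD.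
split=> // c w wc.
rewrite [LHS](_ : _ = lieseries_val (Q 0%N) w + lieseries_val (ssum D) w
  - lieseries_val (Q c) w)//.
rewrite [lieseries_val (ssum D)](lie_sumE sD).
rewrite [X in _ + X - _](@fsum_seq _ _ (index_iota 0 c)) ?iota_uniq//;
  last first.
  move=> d; rewrite mem_index_iota/= -leqNgt => cd; apply: oD.
  exact: leq_trans cd.
have -> : \sum_(0 <= j < c) (val \o D) j w
    = \sum_(0 <= j < c) (lieseries_val (Q j.+1) w - lieseries_val (Q j) w).
  by [].
by rewrite telescope_sumr// [_ + (_ - _)]addrC subrK subrr.
Qed.

(** [P] is the limit of kernel elements [Q c], hence [Q 0] plus a summable family of kernel
    elements, and strong linearity kills that sum. *)
Lemma ker_order_closed (J : finType) (L : summLieType k)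
    (phi : {linear lieseries k J -> L}) (P : lieseries k J) :
  strongly_linear phi -> (forall c, ker_order phi c P) -> phi P = 0.
Proof.
move=> phiS /boolp.choice[Q QP].
have Q0 c : phi (Q c) = 0 by have [] := QP c.
have oQ c : lie_order c (P - Q c) by have [] := QP c.
have oD c : lie_order c (Q c.+1 - Q c).
  have := lie_orderB (oQ c) (lie_order_leq (leqnSn c) (oQ c.+1)).
  by rewrite opprB addrC addrA subrK.
have [sD limD] := lie_limit oD.
(* For every [c], both sides differ from [Q c] by order at least [c]. *)
have -> : P = Q 0%N + ssum (fun c => Q c.+1 - Q c).
  apply/eqP; rewrite -subr_eq0; apply/eqP/lie_order_eq0 => c.
  by have := lie_orderB (oQ c) (limD c); rewrite opprB addrA subrK.
rewrite linearD Q0 add0r; have [_ <-] := phiS _ _ sD.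
have -> : phi \o (fun c => Q c.+1 - Q c) = (fun=> 0).
  by apply/funext => c; rewrite /= linearB/= !Q0 subrr.
have [|_ ->] := SM1 nat (fun=> 0 : L); last exact: fsbig1.
by apply: (sub_finite_set _ (finite_set0 _)) => c /=; rewrite eqxx.
Qed.

End Closedness.

(** * Positive formulas under morphisms *)

Section PositiveFormulas.
Variable k : fieldType.

Definition mixed_morphism (L M : mixedType k) (f : {linear L -> M}) : Prop :=
  lie_morphism f /\ strongly_linear f.

(** [f] after the evaluation at a tuple is an evaluation at the image tuple, so uniqueness of
    evaluations applies. *)
Lemma eval_morphism (L M : mixedType k) (f : {linear L -> M}) (W : Type)
    (e : W -> L) (t : term k W) :
  mixed_morphism f -> eval (f \o e) t = f (eval e t).
Proof.
move=> [fB fS]; elim: t => [//|m g ts IHts] /=.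
rewrite (_ : (fun i => _) = f \o (fun i => eval e (ts i))); last exact/funext.
apply: (evaluation_unique (ev_lieP _) (evaluation_comp fB fS (ev_lieP _))).
Qed.

(** An equation holds at an image tuple iff the difference of its sides, computed in [L], lies in
    the kernel. A larger kernel thus makes more equations true, without any map from [M] to [N]. *)
Lemma satisfies_ker (L M N : mixedType k) (f : {linear L -> M})
    (g : {linear L -> N}) (W : Type) (e : W -> L) (theta : pos_formula k W) :
  mixed_morphism f -> mixed_morphism g -> (forall x, f x = 0%R -> g x = 0%R) ->
  satisfies (f \o e) theta -> satisfies (g \o e) theta.
Proof.
move=> fm gm fg; elim: theta => [s t|A IHA B IHB [/IHA sA /IHB]|A IHA B IHB] /=.
- rewrite !eval_morphism// => /eqP; rewrite -subr_eq0 -linearB => /eqP/fg/eqP.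
  by rewrite linearB subr_eq0 => /eqP.
- by [].
- by case=> [/IHA|/IHB]; [left|right].
Qed.

Lemma satisfies_limit (L M : mixedType k) (f : {linear L -> M})
    (N : nat -> mixedType k) (g : forall c, {linear L -> N c}) (W : Type)
    (e : W -> L) (theta : pos_formula k W) :
  mixed_morphism f -> (forall c, mixed_morphism (g c)) ->
  (forall c d x, (c <= d)%N -> g d x = 0%R -> g c x = 0%R) ->
  (forall x, (forall c, g c x = 0%R) -> f x = 0%R) ->
  (forall c, satisfies (g c \o e) theta) -> satisfies (f \o e) theta.
Proof.
move=> fm gm g_dec gf sat.
(* Truth at all levels does not pass to a disjunct, but truth at cofinally many does; for equations
   it suffices since the kernels decrease. *)
have {sat} : forall c, exists2 d, (c <= d)%N & satisfies (g d \o e) theta.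
  by move=> c; exists c.
elim: theta => [s t|A IHA B IHB|A IHA B IHB] /= sat.
- rewrite !eval_morphism//; apply/eqP; rewrite -GRing.subr_eq0 -GRing.linearB.
  apply/eqP/gf => c; have [d cd] := sat c; rewrite !eval_morphism// => st.
  by apply: g_dec cd _; rewrite GRing.linearB/= st GRing.subrr.
- by split; [apply: IHA|apply: IHB] => c; have [d cd [? ?]] := sat c; exists d.
- have [sA|/existsNP[a nA]] := pselect (forall c, exists2 d,
      (c <= d)%N & satisfies (g d \o e) A); first by left; apply: IHA.
  (* [A] fails at every level from [a] on, so [B] must hold at the level found. *)
  right; apply: IHB => c; have [d] := sat (maxn a c).
  rewrite geq_max => /andP[ad cd] [sA|sB]; last by exists d.
  by case: nA; exists d.
Qed.

End PositiveFormulas.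

(** * Existence and uniqueness of solutions *)

Section ExistenceUniqueness.
Local Open Scope ring_scope.
Variables (k : fieldType) (n p : nat) (theta : pos_formula k ('I_n + 'I_p)).
Hypothesis theta_nilpotent : forall L : mixedType k,
  finite_dimensional L -> lie_nilpotent L -> holds_forall_exists_unique theta L.

Definition sum_env (T : Type) (x : 'I_n -> T) (y : 'I_p -> T)
    (v : 'I_n + 'I_p) : T :=
  match v with inl i => x i | inr j => y j end.

Lemma sum_env_comp (T U : Type) (f : T -> U) x y :
  f \o sum_env x y = sum_env (f \o x) (f \o y).
Proof. by apply/funext => -[]. Qed.

Lemma quot_exists_unique (J : finType) (L : summLieType k)
    (phi : {linear lieseries k J -> L}) (c : nat)
    (q : discrete_quotient (lieseries k J)) :
  (forall P, dq_proj q P = 0 <-> ker_order phi c P) ->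
  holds_forall_exists_unique theta (quot q).
Proof.
move=> qE; apply: theta_nilpotent; last exact: truncation_nilpotent qE.
by exists (dq_dim q); constructor; exists id => //; exists id.
Qed.

Lemma quot_proj_morphism (L : mixedType k) (q : discrete_quotient L) :
  mixed_morphism (quot_proj q).
Proof. by split; [exact: quot_proj_lie|exact: quot_proj_strong]. Qed.

Lemma sum_env_exists (L : mixedType k) (x : 'I_n -> L) :
  exists y, satisfies (sum_env x y) theta.
Proof.
(* With the identity for [phi], the quotients are the truncations of [F] by order. *)
pose F := lieseries k 'I_n; pose phi : {linear F -> F} := idfun.
have /boolp.choice[q qE] := truncation_quotient (phi := phi) (fun _ _ => erefl).
have projE c (P Q : F) :
    quot_proj (q c) P = quot_proj (q c) Q <-> lie_order c (P - Q).
  split=> [PQ|oPQ].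
    have /qE[R [R0]] : quot_proj (q c) (P - Q) = 0.
      by rewrite linearB/= PQ subrr.
    by rewrite -[R]/(phi R) R0 subr0.
  apply/eqP; rewrite -subr_eq0 -linearB; apply/eqP/qE.
  exact: ker_order_of_order.
have morph c := quot_proj_morphism (q c).
(* [Y] lifts, along the section, the unique solution over the generic tuple. *)
have Yex c : exists Y : 'I_p -> F,
    unique
      (fun y => satisfies (sum_env (quot_proj (q c) \o @lievar k _) y) theta)
      (quot_proj (q c) \o Y).
  have [y yP] := quot_exists_unique (qE c) (quot_proj (q c) \o @lievar k _).
  exists (dq_sec (q c) \o y).
  suff -> : quot_proj (q c) \o (dq_sec (q c) \o y) = y by [].
  by apply/funext => j; exact: dq_secK.
have /boolp.choice[Y YP] := Yex.
(* The solution at level [c.+1] remains one at level [c], so uniqueness there identifies it with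
   [Y c] up to order [c]. *)
have oY j c : lie_order c (Y c.+1 j - Y c j).
  apply/projE; have [_ /(_ (quot_proj (q c) \o Y c.+1))] := YP c.
  rewrite -sum_env_comp => /(_ _)/(congr1 (@^~ j)) /= -> //.
  have [+ _] := YP c.+1; rewrite -sum_env_comp; apply: satisfies_ker => //.
  move=> P /eqP; rewrite -(linear0 (quot_proj (q c.+1))) => /eqP/projE oP.
  rewrite -(linear0 (quot_proj (q c))); apply/projE.
  exact: lie_order_leq oP.
pose Yoo j := Y 0 j + ssum (fun c => Y c.+1 j - Y c j).
have YooE c : quot_proj (q c) \o Yoo = quot_proj (q c) \o Y c.
  by apply/funext => j; apply/projE; have [_] := lie_limit (oY j); apply.
have [ev [evB evS evX]] := mixed_evaluations 'I_n x (finite_summable x).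
exists (ev \o Yoo); have -> : x = ev \o @lievar k _.
  by apply/funext => i; rewrite /= evX.
rewrite -sum_env_comp.
(* The kernels of the projections intersect in [0], so truth at all levels gives truth under
   [ev]. *)
apply: (@satisfies_limit _ _ _ ev _ (fun c => quot_proj (q c))) => //.
- move=> c d P cd /eqP; rewrite -(linear0 (quot_proj (q d))) => /eqP/projE oP.
  rewrite -(linear0 (quot_proj (q c))); apply/projE.
  exact: lie_order_leq oP.
- move=> P P0; rewrite (lie_order_eq0 (P := P)) ?linear0// => c.
  by rewrite -[P]subr0; apply/projE; rewrite P0 linear0.
- by move=> c; rewrite sum_env_comp YooE; have [] := YP c.
Qed.

Lemma sum_env_unique (L : mixedType k) (x : 'I_n -> L) (y z : 'I_p -> L) :
  satisfies (sum_env x y) theta -> satisfies (sum_env x z) theta -> y = z.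
Proof.
pose J : finType := ('I_n + ('I_p + 'I_p))%type.
pose a (v : J) : L := match v with
  inl i => x i | inr (inl j) => y j | inr (inr j) => z j end.
have [phi [phiB phiS phiX]] := mixed_evaluations J a (finite_summable a).
pose X i : lieseries k J := lievar (inl i).
pose Y j : lieseries k J := lievar (inr (inl j)).
pose Z j : lieseries k J := lievar (inr (inr j)).
have -> : x = phi \o X by apply/funext => i; rewrite /= phiX.
have -> : y = phi \o Y by apply/funext => j; rewrite /= phiX.
have -> : z = phi \o Z by apply/funext => j; rewrite /= phiX.
rewrite -(sum_env_comp phi X Y) -(sum_env_comp phi X Z).
move=> satY satZ; apply/funext => j.
(* By closedness of the kernel, it suffices that [Y j] and [Z j] agree in each quotient. *)
apply/eqP; rewrite -subr_eq0 -linearB; apply/eqP/ker_order_closed => // c.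
have [q qE] := truncation_quotient phiB c; apply/qE.
have push U : satisfies (phi \o sum_env X U) theta ->
    satisfies (sum_env (quot_proj q \o X) (quot_proj q \o U)) theta.
  rewrite -sum_env_comp; apply: satisfies_ker => //.
    exact: quot_proj_morphism.
  by move=> P P0; apply/qE; exact: ker_order_of_ker.
(* The images of [Y] and [Z] are solutions over the same parameters, hence both equal [u]. *)
have [u [_ uP]] := quot_exists_unique qE (quot_proj q \o X).
have := etrans (esym (uP _ (push _ satY))) (uP _ (push _ satZ)).
by move=> /(congr1 (@^~ j)) /= YZ; rewrite linearB/= [X in X - _]YZ subrr.
Qed.

End ExistenceUniqueness.

Theorem theorem4 (k : fieldType) (char0 : [pchar k]%R =i pred0)
    (n p : nat) (theta : pos_formula k ('I_n + 'I_p)) :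
  (forall L : mixedType k, finite_dimensional L -> lie_nilpotent L ->
    holds_forall_exists_unique theta L) ->
  forall L : mixedType k, holds_forall_exists_unique theta L.
Proof.
move=> theta_nilpotent L x.
have [y sat_y] := sum_env_exists theta_nilpotent x.
exists y; split=> // z sat_z.
exact: (sum_env_unique theta_nilpotent (x := x)).
Qed.
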